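(* Let $n\geq 3$. There exist constants $C,C'>0$ and a smooth family of symplectic embeddings $$i_{S,R}\colon \mathrm{B}^2(1)\times\mathrm{B}^{2(n-1)}(S)\hookrightarrow \mathrm{B}^4(R)\times\mathrm{B}^{2(n-2)}\Big(\tfrac{CS^2}{\sqrt{R-\sqrt{3}}}\Big),$$ where the parameters $(S,R)$ range over the open set $\{(S,R)\in\mathbb{R}^2 : S>0,\ \sqrt{3}<R<\sqrt{3}+C'S^2\}$.
   Context: $\mathbb{R}^{2m}$, with coordinates $(x_1,y_1,\ldots,x_m,y_m)$, carries the standard symplectic form $\sum_i \mathrm{d}x_i\wedge\mathrm{d}y_i$, and $\mathrm{B}^{2m}(\rho)$ denotes the open ball of radius $\rho$ centered at the origin; products of balls are regarded as open subsets of $\mathbb{R}^{2n}$, and a symplectic embedding is a smooth embedding preserving the standard form. Smooth families: for smooth manifolds $P,M,N$ and submanifolds $B_p\subset N$, a family of embeddings $(\phi_p\colon B_p\hookrightarrow M)_{p\in P}$ is smooth if there is a smooth manifold $B$ and a smooth map $g\colon P\times B\to N$ with each $g(p,\cdot)$ an immersion and $B_p=g(p,B)$, such that $\Phi(p,b)=\phi_p(g(p,b))$ is smooth. The family is also called smooth when each $\phi_p$ takes values in a submanifold $M_p\subset M$ containing $\phi_p(B_p)$. Here $N=M=\mathbb{R}^{2n}$, $P$ is the given open set of parameters $(S,R)$, $B_{(S,R)}=\mathrm{B}^2(1)\times\mathrm{B}^{2(n-1)}(S)$, and $M_{(S,R)}=\mathrm{B}^4(R)\times\mathrm{B}^{2(n-2)}\big(CS^2/\sqrt{R-\sqrt{3}}\big)$.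 *)

(* Defs.v *)
From HB Require Import structures.
From mathcomp Require Import all_boot all_order all_algebra.
From mathcomp Require Import all_classical all_reals all_analysis.
Set Implicit Arguments.
Unset Strict Implicit.
Unset Printing Implicit Defensive.
Import Order.TTheory GRing.Theory Num.Theory.
Import numFieldNormedType.Exports.
Local Open Scope classical_set_scope.
Local Open Scope ring_scope.

Section Defs.
Variable R : realType.

Definition coord (m : nat) (u : 'rV[R]_m) (k : nat) : R :=
  match @insub nat (fun k => k < m)%N _ k with
  | Some i => u ord0 i | None => 0 end.

Definition sqsum (m : nat) (u : 'rV[R]_m) (a b : nat) : R :=
  \sum_(a <= k < b) coord u k ^+ 2.

(* standard symplectic form on R^{2n} with coordinates
   (x_1,y_1,...,x_n,y_n) = (coord 0, coord 1, ..., coord (2n-2), coord (2n-1)) *)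
Definition omega (n : nat) (u v : 'rV[R]_(2 * n)) : R :=
  \sum_(0 <= i < n) (coord u (2 * i) * coord v (2 * i + 1)
                     - coord u (2 * i + 1) * coord v (2 * i)).

Fixpoint iter_deriv (m k : nat) (f : 'rV[R]_m -> 'rV[R]_k)
    (vs : seq 'rV[R]_m) : 'rV[R]_m -> 'rV[R]_k :=
  match vs with
  | [::] => f
  | v :: vs' => fun x => derive (iter_deriv f vs') x v
  end.

Definition smooth_on (m k : nat) (A : set 'rV[R]_m)
    (f : 'rV[R]_m -> 'rV[R]_k) : Prop :=
  open A /\
  forall vs : seq 'rV[R]_m,
    (forall x v, A x -> derivable (iter_deriv f vs) x v) /\
    (forall x, A x -> {for x, continuous (iter_deriv f vs)}).

(* smooth embedding of the open set A into R^m: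
   smooth, injective, immersion, homeomorphism onto its image *)
Definition smooth_embedding (m : nat) (A : set 'rV[R]_m)
    (f : 'rV[R]_m -> 'rV[R]_m) : Prop :=
  smooth_on A f /\
  {in A &, injective f} /\
  (forall x v, A x -> derive f x v = 0 -> v = 0) /\
  (forall x, A x -> forall e : R, 0 < e -> exists2 d : R, 0 < d &
     forall y, A y -> `|f y - f x| < d -> `|y - x| < e).

Definition symplectic_embedding (n : nat) (A : set 'rV[R]_(2 * n))
    (f : 'rV[R]_(2 * n) -> 'rV[R]_(2 * n)) : Prop :=
  smooth_embedding A f /\
  forall x u v, A x -> omega (derive f x u) (derive f x v) = omega u v.

Definition dom_SR (n : nat) (S : R) : set 'rV[R]_(2 * n) :=
  [set x | sqsum x 0 2 < 1 /\ sqsum x 2 (2 * n) < S ^+ 2].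

Definition tgt_SR (n : nat) (Rad rho : R) : set 'rV[R]_(2 * n) :=
  [set x | sqsum x 0 4 < Rad ^+ 2 /\ sqsum x 4 (2 * n) < rho ^+ 2].

(* parameter set P = {(S,R) : S > 0, sqrt 3 < R < sqrt 3 + C' S^2},
   a parameter p : 'rV_2 is (S,R) = (p_0, p_1) *)
Definition param_set (C' : R) : set 'rV[R]_2 :=
  [set p | 0 < p ord0 0 /\ Num.sqrt 3 < p ord0 1
           /\ p ord0 1 < Num.sqrt 3 + C' * p ord0 0 ^+ 2].

Definition smooth_family (n : nat) (P : set 'rV[R]_2)
    (B : 'rV[R]_2 -> set 'rV[R]_(2 * n))
    (F : 'rV[R]_2 -> 'rV[R]_(2 * n) -> 'rV[R]_(2 * n)) : Prop :=
  smooth_on [set y : 'rV[R]_(2 + 2 * n) | P (lsubmx y) /\ B (lsubmx y) (rsubmx y)]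
            (fun y => F (lsubmx y) (rsubmx y)).

End Defs.
Arguments dom_SR {R} n S.
Arguments tgt_SR {R} n Rad rho.

(* Main.v *)
Require Import Defs.
From HB Require Import structures.
From mathcomp Require Import all_boot all_order all_algebra.
From mathcomp Require Import all_classical all_reals all_analysis.
From mathcomp Require Import ring lra.
Set Implicit Arguments.
Unset Strict Implicit.
Unset Printing Implicit Defensive.
Import Order.TTheory GRing.Theory Num.Theory.
Import numFieldNormedType.Exports.
Local Open Scope classical_set_scope.
Local Open Scope ring_scope.

(* Write the unit disc as a rectangle (q, s) of area pi, and let g be a small
   multiple of R - sqrt 3. The proof combines two explicit symplectic maps.

   (1) B^2(S) x B^2(S) embeds into Sigma x B^2(O(S^2 / sqrt g)), where Sigma is
   a once punctured torus of area O(g), the plumbing of two thin annuli. The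
   first disc becomes a long strip that runs many times around one annulus;
   each time it crosses the other annulus, x_3 is shifted by 2S, so that
   successive turns become disjoint. By symplecticity this shift drags the
   strip along the second annulus by an amount depending on y_3, which is
   harmless because that annulus is closed up.

   (2) B^2(1) x Sigma embeds into B^4(R). In action-angle coordinates (rho,
   theta) of the second factor both annuli are graphs over the theta-circle that
   cross twice. One crossing is the plumbing. At the other one the unit disc is
   moved off itself along the first annulus by the shear
   (q, rho) -> (q + G, rho - k G), G = G(k theta - s), where G is a square wave
   and k is close to 2. In this travelling wave the points displaced by G in q
   sit at rho = k (1 - G) up to O(g), whence |z_1|^2 + |z_2|^2 <= 3 + O(g). *)

(** The number 3 comes from k. The plumbing needs G = 0 and the other crossing, half a turn away,
    needs G = 1, both for every s in (0, 1). So the travelling wave may move by less than half a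
    turn while s runs through its range, and this forces k > 2. Symplecticity ties the displacement
    G of q to a drop k G of rho = |z_2|^2, which has to stay positive; hence the undisplaced part
    sits at height about k, and |z_1|^2 + |z_2|^2 is about 1 + k at worst. The torus Sigma never
    appears as a space. A single formula in (q, s, u, v, X, Y) is used, u and v being the strip
    coordinates across and along the first annulus, and everything follows a dichotomy on the
    distance from v to the integers: below [w] the wave vanishes and the point follows the second
    annulus; from [w] on the staircase is flat and the point follows the first. The strip makes of
    the order of S^2 / g turns, each costing 2 S in x_3. The final rescaling by sqrt g / S balances
    the resulting length S^3 / g against S, whence S^2 / sqrt g in both directions. *)

Section SmoothCalculus.
Context {R : realType} {V : normedModType R}.
Implicit Types (A B : set V) (f g : V -> R) (x v : V).

(** * Directional derivatives and smooth real-valued functions *)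

Lemma is_derive_ext f g x v (d : R) :
  f =1 g -> is_derive x v f d -> is_derive x v g d.
Proof. by move=> /funext ->. Qed.

Lemma is_derive_chain (phi : R -> R) g x v (dphi dg : R) :
  is_derive (g x) 1 phi dphi -> is_derive x v g dg ->
  is_derive x v (phi \o g) (dphi * dg).
Proof.
move=> dp [gx <-].
pose g1 (h : R) := g (h *: v + x).
have g1d : derivable g1 0 1 by exact: ((derivable1P g x v).1 gx).
have g10 : g1 0 = g x by rewrite /g1 scale0r add0r.
have lineD (k : V -> R) : 'D_v k x = 'D_1 (fun h : R => k (h *: v + x)) 0.
  rewrite /derive; set g2 := fun h => h^-1 *: _; set g3 := fun h => h^-1 *: _.
  suff -> : g2 = g3 by [].
  by apply/funext => h; rewrite /g2 /g3 /= addr0 scale0r add0r [_%:A]mulr1.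
rewrite -g10 in dp.
have D1 : is_derive (0 : R) 1 (phi \o g1) (dphi * 'D_1 g1 0).
  exact: (is_derive1_comp dp (derivableP g1d)).
apply: DeriveDef; first by apply: (derivable1P (phi \o g) x v).2; case: D1.
by rewrite !lineD; case: D1.
Qed.

Lemma is_derive_mul f g x v (df dg : R) : is_derive x v f df ->
  is_derive x v g dg ->
  is_derive x v (fun y => f y * g y) (f x * dg + g x * df).
Proof. exact: is_deriveM. Qed.

Lemma is_derive_scale (c : R) f x v (df : R) : is_derive x v f df ->
  is_derive x v (fun y => c * f y) (c * df).
Proof. exact: is_deriveZ. Qed.

Lemma is_derive_pow f n x v (df : R) : is_derive x v f df ->
  is_derive x v (fun y => f y ^+ n) (n%:R * f x ^+ n.-1 * df).
Proof.
move=> fd; apply: (@is_derive_ext (f ^+ n)).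
by move=> y; rewrite exprfctE.
Qed.

(** The derivative [g'] is existential and tied to [g] on [A] only, so that each induction on [k]
    can supply a closed formula as witness. *)
Fixpoint Ck (k : nat) (A : set V) (g : V -> R) : Prop :=
  (forall x, A x -> {for x, continuous g}) /\
  match k with
  | 0%N => True
  | k'.+1 => forall v, exists2 g', Ck k' A g' &
               forall x, A x -> is_derive x v g (g' x)
  end.

Definition smooth (A : set V) (g : V -> R) := forall k, Ck k A g.

Lemma CkS k A g : Ck k.+1 A g -> Ck k A g.
Proof.
elim: k g => [|k IH] g [gc gd]; first by split.
split=> // v; have [g' g'k g'd] := gd v.
by exists g' => //; exact: IH.
Qed.

Lemma Ck_continuous k A g x : Ck k A g -> A x -> {for x, continuous g}.
Proof. by case: k => [|k] [gc _]; exact: gc. Qed.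

Lemma near_open A x : open A -> A x -> \forall y \near x, A y.
Proof. by move=> oA Ax; exact: open_nbhs_nbhs. Qed.

Lemma Ck_ext k A f g : open A -> (forall x, A x -> f x = g x) ->
  Ck k A f -> Ck k A g.
Proof.
move=> oA fg; have nfg x : A x -> {near x, f =1 g}.
  by move=> Ax; apply: filterS (near_open oA Ax) => y; exact: fg.
have cfg x : A x -> {for x, continuous f} -> {for x, continuous g}.
  move=> Ax; rewrite /prop_for /continuous_at -fg// => fc.
  by apply: cvg_trans fc; apply: near_eq_cvg; exact: nfg.
case: k => [|k] [fc fd].
  by split=> // x Ax; apply: cfg => //; exact: fc.
split=> [x Ax|v]; first by apply: cfg => //; exact: fc.
have [f' f'k f'd] := fd v; exists f' => // x Ax.
by apply: near_eq_is_derive (nfg x Ax) _; exact: f'd.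
Qed.

Lemma Ck_sub k A B g : B `<=` A -> Ck k A g -> Ck k B g.
Proof.
move=> BA; elim: k g => [|k IH] g [gc gd].
  by split=> // x /BA; exact: gc.
split=> [x /BA|v]; first exact: gc.
by have [g' /IH g'k g'd] := gd v; exists g' => // x /BA; exact: g'd.
Qed.

Lemma smooth_ext A f g : open A -> (forall x, A x -> f x = g x) ->
  smooth A f -> smooth A g.
Proof. by move=> oA fg fs k; apply: Ck_ext fg (fs k). Qed.

(** Local witnesses need not fit together, but the directional derivative itself is one global
    witness and agrees with each of them on its own neighbourhood. *)
Lemma smooth_local A g :
  (forall x, A x -> exists B, [/\ open B, B x & smooth B g]) -> smooth A g.
Proof.
have loc1 k x B : open B -> B x -> Ck k.+1 B g ->
   forall v, is_derive x v g ('D_v g x).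
  by move=> oB Bx [_ gd] v; have [g' _ /(_ x Bx)[? _]] := gd v; apply: derivableP.
move=> h k; elim: k g h {loc1} => [|k IH] g h.
  split=> // x Ax; have [B [oB Bx gs]] := h x Ax.
  exact: Ck_continuous (gs 0%N) Bx.
split=> [x Ax|v].
  by have [B [oB Bx gs]] := h x Ax; exact: Ck_continuous (gs 0%N) Bx.
exists (fun x => 'D_v g x).
  apply: IH => x Ax; have [B [oB Bx gs]] := h x Ax.
  exists B; split => // j; have [_ /(_ v)[g' g'j g'd]] := gs j.+1.
  apply: Ck_ext g'j => // y By.
  by have [_ <-] := g'd y By.
move=> x Ax; have [B [oB Bx gs]] := h x Ax.
have [_ /(_ v)[g' g'j /(_ x Bx)[gd _]]] := gs 1%N.
exact: derivableP.
Qed.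

Lemma smooth_derive A g v : open A -> smooth A g ->
  smooth A (fun x => 'D_v g x).
Proof.
move=> oA gs k; have [_ /(_ v)[g' g'k g'd]] := gs k.+1.
by apply: Ck_ext g'k => // x Ax; have [_ <-] := g'd x Ax.
Qed.

Lemma smooth_is_derive A g x v : smooth A g -> A x ->
  is_derive x v g ('D_v g x).
Proof.
move=> gs Ax; have [_ /(_ v)[g' _ /(_ x Ax)[gd _]]] := gs 1%N.
exact: derivableP.
Qed.

Lemma smooth_continuous A g x : smooth A g -> A x -> {for x, continuous g}.
Proof. by move=> gs; exact: Ck_continuous (gs 0%N). Qed.

Lemma smooth_sub A B g : B `<=` A -> smooth A g -> smooth B g.
Proof. by move=> BA gs k; apply: Ck_sub BA (gs k). Qed.

Lemma Ck_cst k A (c : R) : Ck k A (fun=> c).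
Proof.
elim: k c => [|k IH] c; split=> //.
- by move=> x _; exact: cst_continuous.
- by move=> x _; exact: cst_continuous.
- by move=> v; exists (fun=> 0) => // x _; exact: is_derive_cst.
Qed.

Lemma CkD k A f g : Ck k A f -> Ck k A g -> Ck k A (fun x => f x + g x).
Proof.
elim: k f g => [|k IH] f g [fc fd] [gc gd].
  by split=> // x Ax; apply: cvgD; [exact: fc|exact: gc].
split=> [x Ax|v]; first by apply: cvgD; [exact: fc|exact: gc].
have [f' f'k f'd] := fd v; have [g' g'k g'd] := gd v.
exists (fun x => f' x + g' x); first exact: IH.
by move=> x Ax; apply: is_deriveD; [exact: f'd|exact: g'd].
Qed.

Lemma CkM k A f g : Ck k A f -> Ck k A g -> Ck k A (fun x => f x * g x).
Proof.
elim: k f g => [|k IH] f g fk gk; move: (fk) (gk) => [fc fd] [gc gd].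
  by split=> // x Ax; apply: cvgM; [exact: fc|exact: gc].
split=> [x Ax|v]; first by apply: cvgM; [exact: fc|exact: gc].
have [f' f'k f'd] := fd v; have [g' g'k g'd] := gd v.
exists (fun x => f x * g' x + g x * f' x).
  by apply: CkD; apply: IH => //; exact: CkS.
by move=> x Ax; apply: is_deriveM; [exact: f'd|exact: g'd].
Qed.

End SmoothCalculus.

(** * Closure under algebraic operations and composition *)

Section SmoothClosure.
Context {R : realType} {V : normedModType R}.
Implicit Types (A : set V) (f g : V -> R).

Lemma smooth_cst A (c : R) : smooth A (fun=> c).
Proof. by move=> k; exact: Ck_cst. Qed.

Lemma smoothD A f g : smooth A f -> smooth A g -> smooth A (fun x => f x + g x).
Proof. by move=> fs gs k; exact: CkD. Qed.

Lemma smoothM A f g : smooth A f -> smooth A g -> smooth A (fun x => f x * g x).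
Proof. by move=> fs gs k; exact: CkM. Qed.

Lemma smoothN A f : smooth A f -> smooth A (fun x => - f x).
Proof.
move=> fs; have := smoothM (smooth_cst A (-1)) fs.
by under eq_fun do rewrite mulN1r.
Qed.

Lemma smoothB A f g : smooth A f -> smooth A g -> smooth A (fun x => f x - g x).
Proof. by move=> fs gs; apply: smoothD => //; exact: smoothN. Qed.

(** The induction generalises [phi]: differentiating the composite gives a composite with [phi'],
    times a derivative of [g]. *)
Lemma smooth_comp A (U : set R) (phi : R -> R) g :
  open U -> smooth U phi -> smooth A g -> (forall x, A x -> U (g x)) ->
  smooth A (fun x => phi (g x)).
Proof.
move=> oU ps gs AU k; elim: k phi ps => [|k IH] phi ps.
  split=> // x Ax; apply: continuous_comp; first exact: smooth_continuous gs Ax.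
  by apply: smooth_continuous ps _; exact: AU.
split=> [x Ax|v].
  apply: continuous_comp; first exact: smooth_continuous gs Ax.
  by apply: smooth_continuous ps _; exact: AU.
have [p' p's p'd] : exists2 p', smooth U p' & forall y, U y -> is_derive y 1 phi (p' y).
  exists (fun y => 'D_1 phi y); last by move=> y Uy; exact: smooth_is_derive ps Uy.
  exact: smooth_derive.
have [_ /(_ v)[g' g'k g'd]] := gs k.+1.
exists (fun x => p' (g x) * g' x); first by apply: CkM => //; exact: IH.
by move=> x Ax; apply: is_derive_chain; [apply: p'd; exact: AU|exact: g'd].
Qed.


End SmoothClosure.

(** * Inverse, sine, cosine and square root *)

Section SmoothReal.
Context {R : realType}.
Implicit Types (U : set R) (phi : R -> R).

Lemma Ck1_step k U phi phi' :
  (forall x, U x -> is_derive x 1 phi (phi' x)) ->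
  Ck k U phi' -> Ck k.+1 U phi.
Proof.
move=> pd pk; split=> [x /pd[px _]|v].
  exact/differentiable_continuous/derivable1_diffP.
exists (fun x => phi' x * v); first by apply: CkM => //; exact: Ck_cst.
move=> x Ux; apply: (@is_derive_chain _ _ phi id) => //.
exact: pd.
Qed.

Lemma smooth_primitive U phi phi' :
  (forall x, U x -> is_derive x 1 phi (phi' x)) ->
  smooth U phi' -> smooth U phi.
Proof. by move=> pd ps k; apply/CkS/(Ck1_step pd (ps k)). Qed.

Lemma smooth_id U : smooth U id.
Proof.
by apply: (@smooth_primitive _ _ (fun=> 1)); exact: smooth_cst.
Qed.

Lemma open_gt0 : open [set x : R | 0 < x].
Proof. exact: open_gt. Qed.

Lemma smooth_inv_pos : smooth [set x : R | 0 < x] (fun x => x^-1).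
Proof.
(* The family of all c x^(-n) is closed under differentiation, unlike its single member x^(-1). *)
suff H k (c : R) n : Ck k [set x : R | 0 < x] (fun x => c * (x^-1) ^+ n).
  by move=> k; apply: Ck_ext (H k 1 1%N); [exact: open_gt0|move=> x _;
    rewrite mul1r expr1].
have D (b : R) j (x : R) : 0 < x ->
    is_derive x 1 (fun y : R => b * y^-1 ^+ j) (- b * j%:R * x^-1 ^+ j.+1).
  move=> x0; have dV : is_derive x 1 (fun y : R => y^-1) (- x ^- 2 *: 1).
    by apply: is_deriveV => //; rewrite gt_eqF.
  have dZ := is_derive_scale b (is_derive_pow j dV).
  apply: is_derive_eq dZ _; rewrite /GRing.scale /= mulr1.
  case: j => [|j] /=; first by rewrite mulr0n mulr0 !mul0r mulr0.
  by rewrite -!exprVn !exprS; ring.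
elim: k c n => [|k IH] c n.
  split=> // x /= x0; apply/differentiable_continuous/derivable1_diffP.
  by case: (D c n x x0).
by apply: (Ck1_step _ (IH (- c * n%:R) n.+1)) => x; exact: D.
Qed.

Lemma smooth_sin_cos k : Ck k [set: R] sin /\ Ck k [set: R] cos.
Proof.
elim: k => [|k [IHs IHc]].
  by split; split=> // x _; [exact: continuous_sin|exact: continuous_cos].
split; first by apply: Ck1_step IHc => x _; exact: is_derive_sin.
apply: (@Ck1_step _ _ _ (fun x => - sin x)).
have := CkM (Ck_cst k setT (-1)) IHs.
by under eq_fun do rewrite mulN1r.
Qed.

Lemma smooth_sin : smooth [set: R] sin.
Proof. by move=> k; case: (smooth_sin_cos k). Qed.

Lemma smooth_cos : smooth [set: R] cos.
Proof. by move=> k; case: (smooth_sin_cos k). Qed.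

Lemma smooth_sqrt_pos : smooth [set x : R | 0 < x] Num.sqrt.
Proof.
move=> k; elim: k => [|k IH].
  by split=> // x _; exact: sqrt_continuous.
(* Written with sqrt x / x, the derivative contains the square root itself, so the induction
   hypothesis applies to it. *)
apply: (@Ck1_step _ _ _ (fun x => 2^-1 * (Num.sqrt x * x^-1))) => [x /= x0|].
  apply: is_derive_eq; first exact: is_derive1_sqrt.
  have s0 : Num.sqrt x != 0 by rewrite gt_eqF ?sqrtr_gt0.
  rewrite -{3}[x]sqr_sqrtr ?ltW//; field.
  by rewrite s0.
apply: CkM; first exact: Ck_cst.
by apply: CkM => //; exact: smooth_inv_pos.
Qed.

End SmoothReal.

Section SmoothCombinators.
Context {R : realType} {V : normedModType R}.
Implicit Types (A : set V) (f g : V -> R).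

Lemma smoothV A f : smooth A f -> (forall x, A x -> 0 < f x) ->
  smooth A (fun x => (f x)^-1).
Proof.
move=> fs f0; exact: (smooth_comp open_gt0 smooth_inv_pos fs f0).
Qed.

Lemma smooth_sqrt A f : smooth A f -> (forall x, A x -> 0 < f x) ->
  smooth A (fun x => Num.sqrt (f x)).
Proof.
move=> fs f0; exact: (smooth_comp open_gt0 smooth_sqrt_pos fs f0).
Qed.

Lemma smooth_compT A (phi : R -> R) f : smooth setT phi -> smooth A f ->
  smooth A (fun x => phi (f x)).
Proof. by move=> ps fs; apply: (smooth_comp openT ps fs). Qed.

Lemma Ck_sum k A (I : Type) (r : seq I) (F : I -> V -> R) :
  (forall i, Ck k A (F i)) -> Ck k A (fun x => \sum_(i <- r) F i x).
Proof.
move=> Fs; elim: r => [|i r IH].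
  by under eq_fun do rewrite big_nil; exact: Ck_cst.
by under eq_fun do rewrite big_cons; exact: CkD.
Qed.

End SmoothCombinators.

(** * Flat functions, the smooth step and a cut-off identity *)

Section SmoothStep.
Context {R : realType}.

(* [flat 0] is the standard flat function exp (-1/x); the powers of [x^-1]
   make the family stable under differentiation. *)
Definition flat (n : nat) (x : R) : R :=
  if 0 < x then x^-1 ^+ n * expR (- x^-1) else 0.

Lemma flat_pos n x : 0 < x -> 0 < flat n x.
Proof. by move=> x0; rewrite /flat x0 mulr_gt0 ?exprn_gt0 ?invr_gt0 ?expR_gt0. Qed.

Lemma flat_ge0 n x : 0 <= flat n x.
Proof. by case: (ltP 0 x) => [/(flat_pos n)/ltW//|]; rewrite /flat ltNge => ->. Qed.

Lemma flat_le0 n x : x <= 0 -> flat n x = 0.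
Proof. by move=> x0; rewrite /flat ltNge x0. Qed.

Lemma flatS n x : 0 < x -> flat n.+1 x = x^-1 * flat n x.
Proof. by move=> x0; rewrite /flat x0 exprS mulrA. Qed.

(** With t = 1/x this is t^n <= n! e^t, a single term of the exponential series. *)
Lemma flat_bounded n : exists2 C : R, 0 < C & forall x, flat n x <= C.
Proof.
exists n`!%:R => [|x]; first by rewrite ltr0n fact_gt0.
case: (ltP 0 x) => x0; last by rewrite flat_le0.
rewrite /flat x0 expRN ler_pdivrMr ?expR_gt0//.
case: n => [|n]; first by rewrite expr0 fact0 mul1r ltW// pexpR_gt1 ?invr_gt0.
have := @expR_ge1Dxn _ (x^-1) n; rewrite invr_ge0 ltW// => /(_ isT) h.
rewrite mulrC -ler_pdivrMr ?ltr0n ?fact_gt0//.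
by apply: le_trans h; rewrite lerDr.
Qed.

Lemma is_derive_flat n (x : R) :
  is_derive x 1 (flat n) (flat n.+2 x - n%:R * flat n.+1 x).
Proof.
case: (ltgtP x 0) => [x0|x0|->].
- rewrite !flat_le0 ?ltW// mulr0 subr0.
  apply: (@near_eq_is_derive _ _ _ (cst 0)).
  near=> y; rewrite flat_le0//; apply/ltW; near: y; exact: lt_nbhsl.
- apply: (@near_eq_is_derive _ _ _
    (fun y : R => y^-1 ^+ n * (expR \o (fun y => - y^-1)) y)).
    near=> y; rewrite /flat ifT //.
    by near: y; exact: lt_nbhsr.
  have dV : is_derive x 1 (fun y : R => y^-1) (- x ^- 2 *: 1).
    by apply: is_deriveV => //; rewrite gt_eqF.
  have dX := is_derive_pow n dV.
  have dE : is_derive x 1 (expR \o (fun y : R => - y^-1))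
      (expR (- x^-1) * - (- x ^- 2 *: 1)).
    exact: is_derive_chain.
  have dM := is_derive_mul dX dE.
  apply: is_derive_eq dM _.
  rewrite /flat x0 /GRing.scale /= mulr1.
  case: n {dX} => [|n] /=; first by rewrite -!exprVn !exprS !expr0; ring.
  rewrite -!exprVn !exprS; ring.
- rewrite !flat_le0// mulr0 subr0.
  have [C C0 hC] := flat_bounded n.+2.
  (* For h > 0 the difference quotient at 0 is [flat n.+1 h] = h [flat n.+2 h], at most h C. *)
  have cvg0 : (fun h : R => h^-1 *: (flat n (h *: 1 + 0) - flat n 0)) @ 0^' --> (0 : R).
    apply/cvgrPdist_le => e e0; near=> h.
    rewrite sub0r normrN [flat n 0]flat_le0// subr0 addr0 [h *: 1]mulr1 /GRing.scale/=.
    case: (ltP 0 h) => h0; last by rewrite flat_le0// mulr0 normr0 ltW.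
    rewrite -flatS// ger0_norm ?flat_ge0//.
    have -> : flat n.+1 h = h * flat n.+2 h by
      rewrite (@flatS n.+1)// mulrA divff ?mul1r// gt_eqF.
    apply: (@le_trans _ _ (h * C)); first by rewrite ler_pM2l.
    rewrite -ler_pdivlMr//; apply: le_trans (ler_norm _) _.
    near: h; apply: dnbhs0_le; exact: divr_gt0.
  by apply: DeriveDef; [apply/cvg_ex; exists 0|apply: cvg_lim].
Unshelve. all: by end_near. Qed.

Lemma smooth_flat n : smooth setT (flat n).
Proof.
move=> k; elim: k n => [|k IH] n.
  split=> // x _; apply/differentiable_continuous/derivable1_diffP.
  by case: (is_derive_flat n x).
apply: (@Ck1_step _ _ _ _ (fun x => flat n.+2 x + (- n%:R) * flat n.+1 x)).
  by move=> x _; rewrite mulNr; exact: is_derive_flat.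
by apply: CkD => //; apply: CkM => //; exact: Ck_cst.
Qed.

Definition step (x : R) : R :=
  flat 0 (2^-1 + x) / (flat 0 (2^-1 + x) + flat 0 (2^-1 - x)).

Lemma step_denom_gt0 (x : R) : 0 < flat 0 (2^-1 + x) + flat 0 (2^-1 - x).
Proof.
have [x0|x0] := ltP (- 2^-1) x.
  by rewrite ltr_wpDr ?flat_ge0// flat_pos//; lra.
by rewrite ltr_wpDl ?flat_ge0// flat_pos//; lra.
Qed.

Lemma smooth_step : smooth setT step.
Proof.
have f1 : smooth setT (fun x : R => flat 0 (2^-1 + x)).
  apply: smooth_compT; first exact: smooth_flat.
  by apply: smoothD; [exact: smooth_cst|exact: smooth_id].
have f2 : smooth setT (fun x : R => flat 0 (2^-1 - x)).
  apply: smooth_compT; first exact: smooth_flat.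
  by apply: smoothB; [exact: smooth_cst|exact: smooth_id].
apply: smoothM => //; apply: smoothV; first exact: smoothD.
by move=> x _; exact: step_denom_gt0.
Qed.

Lemma step0 x : x <= - 2^-1 -> step x = 0.
Proof. by move=> h; rewrite /step flat_le0 ?mul0r//; lra. Qed.

Lemma step1 x : 2^-1 <= x -> step x = 1.
Proof.
move=> h; rewrite /step [flat 0 (_ - x)]flat_le0; last lra.
by rewrite addr0 divff// gt_eqF// flat_pos//; lra.
Qed.

Lemma step_itv x : 0 <= step x <= 1.
Proof.
have d0 := step_denom_gt0 x.
rewrite /step divr_ge0 ?flat_ge0 ?(ltW d0)//=.
by rewrite ler_pdivrMr// mul1r lerDl flat_ge0.
Qed.

(** A bump equal to 1 for |t| <= 5/4 and to 0 for |t| >= 7/4. The plateau reaches beyond 1 so that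
    [zt w] is affine on a neighbourhood of each closed interval |v - z| <= w. *)
Definition chi (t : R) : R := step (3 - 2 * t) * step (3 + 2 * t).

Definition cutid (t : R) : R := t * chi t.

Lemma smooth_cutid : smooth setT cutid.
Proof.
have s2 : smooth setT (fun t : R => 2 * t).
  by apply: smoothM; [exact: smooth_cst|exact: smooth_id].
apply: smoothM; first exact: smooth_id.
apply: smoothM; apply: smooth_compT (smooth_step) _.
  by apply: smoothB => //; exact: smooth_cst.
by apply: smoothD => //; exact: smooth_cst.
Qed.

Lemma chi_itv t : 0 <= chi t <= 1.
Proof.
have /andP[a0 a1] := step_itv (3 - 2 * t).
have /andP[b0 b1] := step_itv (3 + 2 * t).
by rewrite mulr_ge0//= mulr_ile1.
Qed.

Lemma cutidE t : `|t| <= 5/4 -> cutid t = t.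
Proof.
rewrite ler_norml => /andP[t1 t2].
by rewrite /cutid /chi !step1 ?mulr1//; lra.
Qed.

Lemma cutid_eq0 t : 7/4 <= `|t| -> cutid t = 0.
Proof.
rewrite ler_normr => /orP[h|h]; rewrite /cutid /chi.
  by rewrite [step (3 - _)]step0 ?mul0r ?mulr0//; lra.
by rewrite [step (3 + _)]step0 ?mulr0//; lra.
Qed.

Lemma cutid_norm t : `|cutid t| <= 2.
Proof.
case: (leP (7/4) `|t|) => h; first by rewrite cutid_eq0 ?normr0//; lra.
have /andP[a0 a1] := chi_itv t.
rewrite /cutid normrM (ger0_norm a0).
by apply: (@le_trans _ _ (`|t| * 1)); [exact: ler_wpM2l|rewrite mulr1; lra].
Qed.

Lemma cutid_sign t : 0 <= t -> 0 <= cutid t.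
Proof. by move=> t0; have /andP[a0 _] := chi_itv t; rewrite mulr_ge0. Qed.

Lemma cutid_sign_neg t : t <= 0 -> cutid t <= 0.
Proof. by move=> t0; have /andP[a0 _] := chi_itv t; rewrite mulr_le0_ge0. Qed.

End SmoothStep.

(** * Staircases built on the nearest integer *)

Section Staircase.
Context {R : realType}.
Implicit Types (w v x z : R).

Definition nint v : R := (Num.floor (v + 2^-1))%:~R.

Lemma nint_itv v : nint v - 2^-1 <= v < nint v + 2^-1.
Proof.
rewrite /nint; have := floor_itv (v + 2^-1).
by move: (Num.floor _) => n; rewrite intrD => /andP[h1 h2]; apply/andP; split; lra.
Qed.

Lemma nint_int v : nint v \is a Num.int.
Proof. exact: intr_int. Qed.

Lemma nintDz v z : z \is a Num.int -> nint (v + z) = nint v + z.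
Proof. move=> /intrP[n ->];
  by rewrite /nint addrAC floorDrz ?intr_int// intrD intrKfloor. Qed.

(** [nint] jumps at half-integers, where the step functions built on it have already saturated and
    do not notice the jump. The radius 3/4 > 1/2 lets a formula anchored at [z] hold across the
    jump. *)
Lemma nint_near v z : z \is a Num.int -> `|v - z| <= 3/4 ->
  [\/ nint v = z,
      nint v = z + 1 /\ 2^-1 <= v - z |
      nint v = z - 1 /\ v - z <= - 2^-1].
Proof.
move=> /intrP[n ->] h; have := nint_itv v; rewrite /nint; move: (Num.floor _) => N h2.
move: h; rewrite ler_norml => /andP[h3 h4]; move: h2 => /andP[h1 h2].
have c1 : (N%:~R : R) < (n + 2)%:~R by rewrite intrD; lra.
have c2 : (n - 2)%:~R < (N%:~R : R) by rewrite intrB; lra.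
move: c1 c2; rewrite !ltr_int => c1 c2.
have [E|E|E] : [\/ N = n, N = n + 1 | N = n - 1].
  case: (ltgtP N n) => c; [apply: Or33|apply: Or32|exact: Or31].
    by apply/eqP; rewrite eq_le -ltzD1 subrK c/= lerBlDr -ltzD1 -addrA -ltrBlDr.
  by apply/eqP; rewrite eq_le -[N <= _]ltzD1 -addrA c1 lezD1 c.
- by apply: Or31; rewrite E.
- by apply: Or32; move: h1 h2; rewrite E intrD => h1 h2; split=> //; lra.
- by apply: Or33; move: h1 h2; rewrite E intrB => h1 h2; split=> //; lra.
Qed.

Lemma derive_const_near (f : R -> R) (x c : R) :
  (\forall y \near x, f y = c) -> is_derive x 1 f 0.
Proof.
move=> fc; apply: (@near_eq_is_derive _ _ _ (cst c)).
by apply: filterS fc => y /= ->.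
Qed.

Definition dstep : R -> R := fun x => 'D_1 step x.

Lemma is_derive_step x : is_derive x 1 step (dstep x).
Proof. exact: (smooth_is_derive (x := x) 1 smooth_step I). Qed.

Lemma smooth_dstep : smooth setT dstep.
Proof. apply: smooth_derive; [exact: openT|exact: smooth_step]. Qed.

Lemma dstep_eq0 x : 2^-1 < `|x| -> dstep x = 0.
Proof.
have [_ <-] := is_derive_step x; rewrite ltr_normr => /orP[h|h].
  apply: (@derive_val _ _ _ _ _ _ _ (derive_const_near _ (c := 1))).
  by near=> y; rewrite step1// ltW//; near: y; exact: lt_nbhsr.
apply: (@derive_val _ _ _ _ _ _ _ (derive_const_near _ (c := 0))).
near=> y; rewrite step0// ltW//; near: y; apply: lt_nbhsl; lra.
Unshelve. all: by end_near. Qed.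

(* [st w] is a smooth staircase rising by 1 within w/2 of each integer, [dst w]
   its derivative, and [zt w v] is the signed distance from v to the nearest
   integer, cut off at distance 2w. *)
Definition st w v : R := nint v + step ((v - nint v) / w).
Definition dst w v : R := dstep ((v - nint v) / w) / w.
Definition zt w v : R := w * cutid ((v - nint v) / w).

Lemma norm_div_pos w v : 0 < w -> `|v / w| = `|v| / w.
Proof. by move=> w0; rewrite normrM (gtr0_norm (x := w^-1)) ?invr_gt0. Qed.

Lemma stE w v z : 0 < w <= 8^-1 -> z \is a Num.int -> `|v - z| <= 3/4 ->
  st w v = z + step ((v - z) / w).
Proof.
move=> /andP[w0 w8] zi h; have := h; rewrite ler_norml => /andP[h1 h2].
have [E|[E h3]|[E h3]] := nint_near zi h; rewrite /st E; first by [].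
- have -> : step ((v - (z + 1)) / w) = 0 by apply: step0; rewrite ler_pdivrMr//; lra.
  have -> : step ((v - z) / w) = 1 by apply: step1; rewrite ler_pdivlMr//; lra.
  by rewrite addr0.
- have -> : step ((v - z) / w) = 0 by apply: step0; rewrite ler_pdivrMr//; lra.
  have -> : step ((v - (z - 1)) / w) = 1 by apply: step1; rewrite ler_pdivlMr//; lra.
  by rewrite addr0 subrK.
Qed.

Lemma dstE w v z : 0 < w <= 8^-1 -> z \is a Num.int -> `|v - z| <= 3/4 ->
  dst w v = dstep ((v - z) / w) / w.
Proof.
move=> /andP[w0 w8] zi h; have := h; rewrite ler_norml => /andP[h1 h2].
have [E|[E h3]|[E h3]] := nint_near zi h; rewrite /dst E; first by [].
- rewrite !dstep_eq0 // norm_div_pos// ltr_pdivlMr// ltr_normr; apply/orP;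
  [left|right]; lra.
- rewrite !dstep_eq0 // norm_div_pos// ltr_pdivlMr// ltr_normr; apply/orP;
  [right|left]; lra.
Qed.

Lemma ztE w v z : 0 < w <= 8^-1 -> z \is a Num.int -> `|v - z| <= 3/4 ->
  zt w v = w * cutid ((v - z) / w).
Proof.
move=> /andP[w0 w8] zi h; have := h; rewrite ler_norml => /andP[h1 h2].
have [E|[E h3]|[E h3]] := nint_near zi h; rewrite /zt E; first by [].
- rewrite !cutid_eq0 // norm_div_pos// ler_pdivlMr// ler_normr; apply/orP;
  [left|right]; lra.
- rewrite !cutid_eq0 // norm_div_pos// ler_pdivlMr// ler_normr; apply/orP;
  [right|left]; lra.
Qed.

Lemma stDz w v z : z \is a Num.int -> st w (v + z) = st w v + z.
Proof. by move=> zi; rewrite /st nintDz// opprD addrACA subrr addr0 addrAC. Qed.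

Lemma ztDz w v z : z \is a Num.int -> zt w (v + z) = zt w v.
Proof. by move=> zi; rewrite /zt nintDz// opprD addrACA subrr addr0. Qed.

Lemma st_itv w v z : 0 < w <= 8^-1 -> z \is a Num.int -> `|v - z| <= 3/4 ->
  z <= st w v <= z + 1.
Proof.
move=> ww zi h; rewrite (stE ww zi h); have /andP[] := step_itv ((v - z) / w).
by move=> *; apply/andP; split; lra.
Qed.

Lemma st_plateau w v z : 0 < w <= 8^-1 -> z \is a Num.int ->
  z + w / 2 <= v <= z + 1 - w / 2 ->
  st w v = z + 1.
Proof.
move=> ww zi /andP[h1 h2]; have /andP[w0 w8] := ww; case: (leP (v - z) 2^-1) => h3.
  rewrite (@stE w _ z)//; last by rewrite ler_norml; apply/andP; split; lra.
  by rewrite step1// ler_pdivlMr//; lra.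
rewrite (@stE w _ (z + 1)) ?rpredD ?rpred1//; last by rewrite ler_norml; apply/andP;
  split; lra.
by rewrite step0 ?addr0// ler_pdivrMr//; lra.
Qed.

Lemma st_bound w v : `|st w v| <= `|v| + 2.
Proof.
rewrite /st; have /andP[h1 h2] := nint_itv v.
have /andP[h3 h4] := step_itv ((v - nint v) / w).
have := ler_norm v; have := ler_norm (- v); rewrite normrN => a1 a2.
by rewrite ler_norml; apply/andP; split; lra.
Qed.

Lemma near_int v z : `|v - z| < 3/4 ->
  \forall y \near v, `|y - z| < 3/4.
Proof.
rewrite ltr_norml => /andP[h1 h2]; near=> y.
rewrite ltr_norml; apply/andP; split.
  by rewrite ltrBrDr; near: y; apply: lt_nbhsr; lra.
by rewrite ltrBlDr; near: y; apply: lt_nbhsl; lra.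
Unshelve. all: by end_near. Qed.

Lemma nint_lt v : `|v - nint v| < 3/4.
Proof.
have := nint_itv v; move: (nint v) => z.
by move=> /andP[h1 h2]; rewrite ltr_norml; apply/andP; split; lra.
Qed.

Lemma is_derive_affine w z v : is_derive v 1 (fun y : R => (y - z) / w) w^-1.
Proof.
have dB : is_derive v 1 (fun y : R => y - z) (1 - 0) by exact: is_deriveB.
apply: (@is_derive_ext _ _ (fun y => w^-1 * (y - z))).
  by move=> y; rewrite mulrC.
by apply: is_derive_eq (is_derive_scale w^-1 dB) _; rewrite subr0 mulr1.
Qed.

Lemma is_derive_st w v : 0 < w <= 8^-1 -> is_derive v 1 (st w) (dst w v).
Proof.
move=> ww; have zi := nint_int v; have := nint_lt v; move: (nint v) zi => z zi h.
rewrite (dstE ww zi (ltW h)).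
apply: (@near_eq_is_derive _ _ _
  (fun y => z + (step \o (fun y : R => (y - z) / w)) y)).
  by apply: filterS (near_int h) => y hy; rewrite (stE ww zi (ltW hy)).
rewrite -[X in is_derive _ _ _ X]add0r; apply: is_deriveD.
exact: (is_derive_chain (is_derive_step _) (is_derive_affine _ _ _)).
Qed.


(** The staircase rises only within w/2 of an integer; cutting at w leaves room for a whole
    neighbourhood of [v], so that derivatives can be read off as well. *)
Lemma dst_near0 w v : 0 < w <= 8^-1 -> w <= `|v - nint v| ->
  \forall y \near v, dst w y = 0.
Proof.
move=> ww hv; have zi := nint_int v; have := nint_lt v; have /andP[w0 w8] := ww.
move: (nint v) zi hv => z zi hv h.
have h2 : \forall y \near v, w / 2 < `|y - z|.
  move: hv; rewrite ler_normr => /orP[hv|hv].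
    near=> y; rewrite ltr_normr; apply/orP; left; rewrite ltrBrDr.
    by near: y; apply: lt_nbhsr; lra.
  near=> y; rewrite ltr_normr; apply/orP; right; rewrite opprB ltrBrDr -ltrBrDl.
  by near: y; apply: lt_nbhsl; lra.
apply: filterS2 (near_int h) h2 => y hy hy2.
rewrite (dstE ww zi (ltW hy)) dstep_eq0 ?mul0r// norm_div_pos// ltr_pdivlMr//.
by lra.
Unshelve. all: by end_near. Qed.

Lemma zt_near w v z : 0 < w <= 8^-1 -> z \is a Num.int -> `|v - z| <= w ->
  \forall y \near v, zt w y = y - z.
Proof.
move=> ww zi; have /andP[w0 w8] := ww; rewrite ler_norml => /andP[h1 h2].
near=> y; have hy : `|y - z| < 5/4 * w.
  rewrite ltr_norml; apply/andP; split.
    by rewrite ltrBrDr; near: y; apply: lt_nbhsr; lra.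
  by rewrite ltrBlDr; near: y; apply: lt_nbhsl; lra.
rewrite (ztE ww zi); last by rewrite (le_trans (ltW hy))//; lra.
rewrite cutidE; first by rewrite mulrCA divff ?mulr1// gt_eqF.
by rewrite norm_div_pos// ler_pdivrMr// ltW.
Unshelve. all: by end_near. Qed.

Lemma zt_id w v z : 0 < w <= 8^-1 -> z \is a Num.int -> `|v - z| <= w ->
  zt w v = v - z.
Proof. by move=> ww zi h; exact: nbhs_singleton (zt_near ww zi h). Qed.

Lemma zt_norm w v : 0 < w -> `|zt w v| <= 2 * w.
Proof.
by move=> w0; rewrite /zt normrM (gtr0_norm w0) mulrC ler_pM2r// cutid_norm.
Qed.

Lemma zt_sign w t : 0 < w -> -(2^-1) <= t < 2^-1 ->
  (0 <= t -> 0 <= zt w t) /\ (t <= 0 -> zt w t <= 0).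
Proof.
move=> w0 /andP[h1 h2].
have nt : nint t = 0.
  rewrite /nint (@floor_def _ _ 0)//=; apply/andP; split; rewrite ?add0r; lra.
rewrite /zt nt subr0; split=> h.
  by rewrite mulr_ge0 ?(ltW w0)// cutid_sign// divr_ge0// ltW.
by rewrite mulr_ge0_le0 ?(ltW w0)// cutid_sign_neg// mulr_le0_ge0// invr_ge0 ltW.
Qed.

End Staircase.

(** * Joint smoothness of the staircases in width and argument *)

Section GlueSmooth.
Context {R : realType} {V : normedModType R}.
Implicit Types (A : set V) (g t : V -> R).

Lemma open_preimage_in A g (U : set R) : open A ->
  (forall x, A x -> {for x, continuous g}) -> open U ->
  open (A `&` [set x | U (g x)]).
Proof.
move=> oA gc oU; rewrite openE => x [Ax Ugx].
apply: filterI; first exact: open_nbhs_nbhs.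
by apply: gc => //; exact: open_nbhs_nbhs.
Qed.

(** The open windows of radius 3/4 about the integers cover the line with overlaps, so [F] is
    locally one of the smooth functions [Psi z]. *)
Lemma smooth_glue A g (Psi : R -> V -> R) (F : V -> R) : open A -> smooth A g ->
  (forall z, z \is a Num.int -> smooth A (Psi z)) ->
  (forall z x, z \is a Num.int -> A x -> `|g x - z| <= 3/4 -> F x = Psi z x) ->
  smooth A F.
Proof.
move=> oA gs Ps FE; apply: smooth_local => x Ax.
pose z := nint (g x); have zi : z \is a Num.int := nint_int _.
exists (A `&` [set y | `|g y - z| < 3/4]).
have oB : open (A `&` [set y | `|g y - z| < 3/4]).
  apply: (@open_preimage_in A g [set r | `|r - z| < 3/4]) => //.
    by move=> y; exact: smooth_continuous gs.
  rewrite openE => r /= hr; exact: near_int.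
split=> //; first by split=> //; exact: nint_lt.
apply: (@smooth_ext _ _ _ (Psi z)) => //.
  by move=> y [Ay hy]; rewrite (FE z)// ltW.
by apply: smooth_sub (Ps z zi) => y [].
Qed.

Section Compose.
Variables (A : set V) (g t : V -> R).
Hypotheses (oA : open A) (gs : smooth A g) (ts : smooth A t).
Hypothesis t8 : forall x, A x -> 0 < t x <= 8^-1.

Let smooth_arg z : smooth A (fun x => (g x - z) / t x).
Proof.
apply: smoothM; first by apply: smoothB => //; exact: smooth_cst.
by apply: smoothV => // x /t8 /andP[].
Qed.

Lemma smooth_st : smooth A (fun x => st (t x) (g x)).
Proof.
apply: (smooth_glue (Psi := fun z x => z + step ((g x - z) / t x)) oA gs).
  move=> z _; apply: smoothD; first exact: smooth_cst.
  exact: smooth_compT smooth_step (smooth_arg z).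
by move=> z x zi Ax h; rewrite (@stE _ _ _ z)//; exact: t8.
Qed.

Lemma smooth_dst : smooth A (fun x => dst (t x) (g x)).
Proof.
apply: (smooth_glue (Psi := fun z x => dstep ((g x - z) / t x) / t x) oA gs).
  move=> z _; apply: smoothM; last by apply: smoothV => // x /t8 /andP[].
  exact: smooth_compT smooth_dstep (smooth_arg z).
by move=> z x zi Ax h; rewrite (@dstE _ _ _ z)//; exact: t8.
Qed.

Lemma smooth_zt : smooth A (fun x => zt (t x) (g x)).
Proof.
apply: (smooth_glue (Psi := fun z x => t x * cutid ((g x - z) / t x)) oA gs).
  move=> z _; apply: smoothM => //.
  exact: smooth_compT smooth_cutid (smooth_arg z).
by move=> z x zi Ax h; rewrite (@ztE _ _ _ z)//; exact: t8.
Qed.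

End Compose.
End GlueSmooth.

(** * The square wave and the profile of the second annulus *)

Section Profiles.
Context {R : realType}.
Implicit Types (w v t y s m b c z : R).

Lemma st_eq0 w v : 0 < w <= 8^-1 -> -1 + w / 2 <= v <= - (w / 2) -> st w v = 0.
Proof.
move=> ww /andP[h1 h2]; rewrite (@st_plateau _ _ _ (-1))// ?rpredN ?rpred1 ?addNr//.
by apply/andP; split; lra.
Qed.

Lemma st_eq1 w v : 0 < w <= 8^-1 -> w / 2 <= v <= 1 - w / 2 -> st w v = 1.
Proof.
move=> ww /andP[h1 h2]; rewrite (@st_plateau _ _ _ 0)// ?rpred0 ?add0r//.
by apply/andP; split; lra.
Qed.

(** Risers have width w, so at most one of y and y + c lies on a riser. The other then sits on a
    plateau whose height is one of the two ends of that riser. *)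
Lemma st_shift_itv w y c : 0 < w <= 8^-1 -> w <= c <= 1 - w ->
  0 <= st w (y + c) - st w y <= 1.
Proof.
move=> ww /andP[c1 c2]; have /andP[w0 w8] := ww.
have zi := nint_int y; have /andP[t1 t2] := nint_itv y.
move: (nint y) zi t1 t2 => z zi t1 t2.
have zi1 : z - 1 \is a Num.int by rewrite rpredB ?rpred1.
have zi2 : z + 1 \is a Num.int by rewrite rpredD ?rpred1.
case: (leP (y - z) (- (w / 2))) => [h|h].
  have -> : st w y = z by rewrite (st_plateau ww zi1) ?subrK//; apply/andP; split; lra.
  case: (leP (y + c - z) (3/4)) => [h3|h3].
    have /andP[a1 a2] : z <= st w (y + c) <= z + 1.
      by apply: st_itv => //; rewrite ler_norml; apply/andP; split; lra.
    by apply/andP; split; lra.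
  rewrite (st_plateau ww zi); last by apply/andP; split; lra.
  by apply/andP; split; lra.
case: (ltP (y - z) (w / 2)) => [h2|h2].
  rewrite (st_plateau ww zi); last by apply/andP; split; lra.
  have /andP[a1 a2] : z <= st w y <= z + 1.
    by apply: st_itv => //; rewrite ler_norml; apply/andP; split; lra.
  by apply/andP; split; lra.
have -> : st w y = z + 1 by rewrite (st_plateau ww zi)//; apply/andP; split; lra.
case: (leP (y + c - z) (1 - w / 2)) => [h3|h3].
  rewrite (st_plateau ww zi); last by apply/andP; split; lra.
  by apply/andP; split; lra.
have /andP[a1 a2] : z + 1 <= st w (y + c) <= z + 1 + 1.
  by apply: st_itv => //; rewrite ler_norml; apply/andP; split; lra.
by apply/andP; split; lra.
Qed.

(* Square wave of period 1, equal to 1 on [9w, 1/2 + 7w] and to 0 on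
   [-1/2 + 9w, 7w]. *)
Definition wave w y : R := st w (y - 8 * w) - st w (y - 2^-1 - 8 * w).

(* [up w] and [down w] are 1 on [6w, 1/2 - w] and on [-1/2 + w, -6w]. *)
Definition up w t : R := st w (t - 5 * w) - st w (t - 2^-1).
Definition down w t : R := st w (t + 2^-1) - st w (t + 5 * w).

(** The k of the travelling wave: s / k stays in (0, 1/2 - 15 w), so a wave delayed by s / k is
    still 0 around the plumbing at 0 and still 1 around 1/2, with a margin of several w on each
    side. *)
Definition speed w : R := (2^-1 - 15 * w)^-1.

(* Radial profile of the second annulus: it crosses the level [b] with slope
   [m] at 0, and jumps back from the high to the low level at 1/2. *)
Definition profile w m b t : R := b + m * zt (8 * w) t
  + 4 * (m * w) * up w t - (speed w + 4 * (m * w)) * down w t.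

Lemma waveDz w y z : z \is a Num.int -> wave w (y + z) = wave w y.
Proof.
move=> zi; rewrite /wave.
have -> : y + z - 8 * w = y - 8 * w + z by ring.
have -> : y + z - 2^-1 - 8 * w = y - 2^-1 - 8 * w + z by ring.
by rewrite !(stDz _ _ zi); ring.
Qed.

Lemma profileDz w m b t z : z \is a Num.int ->
  profile w m b (t + z) = profile w m b t.
Proof.
move=> zi; rewrite /profile /up /down ztDz//.
have -> : t + z - 5 * w = t - 5 * w + z by ring.
have -> : t + z - 2^-1 = t - 2^-1 + z by ring.
have -> : t + z + 5 * w = t + 5 * w + z by ring.
have -> : t + z + 2^-1 = t + 2^-1 + z by ring.
by rewrite !(stDz _ _ zi); ring.
Qed.

Lemma small_width w : 0 < w <= 100^-1 -> 0 < w <= 8^-1.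
Proof. by move=> /andP[h1 h2]; apply/andP; split; lra. Qed.

Lemma small_width8 w : 0 < w <= 100^-1 -> 0 < 8 * w <= 8^-1.
Proof. by move=> /andP[h1 h2]; apply/andP; split; lra. Qed.

Lemma wave_itv w y : 0 < w <= 100^-1 -> 0 <= wave w y <= 1.
Proof.
move=> ww; have /andP[w0 w1] := ww; rewrite /wave.
have -> : y - 8 * w = y - 2^-1 - 8 * w + 2^-1 by lra.
by apply: st_shift_itv; [exact: small_width|apply/andP; split; lra].
Qed.

Lemma up_itv w y : 0 < w <= 100^-1 -> 0 <= up w y <= 1.
Proof.
move=> ww; have /andP[w0 w1] := ww; rewrite /up.
have -> : y - 5 * w = y - 2^-1 + (2^-1 - 5 * w) by lra.
by apply: st_shift_itv; [exact: small_width|apply/andP; split; lra].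
Qed.

Lemma down_itv w y : 0 < w <= 100^-1 -> 0 <= down w y <= 1.
Proof.
move=> ww; have /andP[w0 w1] := ww; rewrite /down.
have -> : y + 2^-1 = y + 5 * w + (2^-1 - 5 * w) by lra.
by apply: st_shift_itv; [exact: small_width|apply/andP; split; lra].
Qed.

Lemma wave_eq0 w y : 0 < w <= 100^-1 -> -2^-1 + 17 / 2 * w <= y <= 15 / 2 * w ->
  wave w y = 0.
Proof.
move=> ww /andP[h1 h2]; have ww8 := small_width ww; have /andP[w0 w1] := ww.
rewrite /wave !st_eq0 ?subr0//; apply/andP; split; lra.
Qed.

Lemma wave_eq1 w y : 0 < w <= 100^-1 -> 17 / 2 * w <= y <= 2^-1 + 15 / 2 * w ->
  wave w y = 1.
Proof.
move=> ww /andP[h1 h2]; have ww8 := small_width ww; have /andP[w0 w1] := ww.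
rewrite /wave st_eq1// ?st_eq0 ?subr0//; apply/andP; split; lra.
Qed.

Lemma speed_gt0 w : 0 < w <= 100^-1 -> 0 < speed w.
Proof. by move=> /andP[w0 w1]; rewrite /speed invr_gt0; lra. Qed.

Lemma speedV w : 0 < w <= 100^-1 -> (speed w)^-1 = 2^-1 - 15 * w.
Proof. by rewrite /speed invrK. Qed.

Lemma speed_ge1 w : 0 < w <= 100^-1 -> 1 <= speed w.
Proof. by move=> /andP[w0 w1]; rewrite /speed invf_ge1; lra. Qed.

Lemma speed_le w : 0 < w <= 100^-1 -> speed w <= 2 + 100 * w.
Proof.
move=> /andP[w0 w1]; rewrite /speed invf_ple ?posrE; [|lra..].
rewrite -[leLHS]mul1r ler_pdivrMr; last lra.
have : 0 <= w * (100^-1 - w) by apply: mulr_ge0; lra.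
rewrite mulrBr; nra.
Qed.

Section ProfileValues.
Variables (w m b : R).
Hypotheses (ww : 0 < w <= 100^-1) (m0 : 0 < m).

Lemma profile_linear t : `|t| <= 4 * w -> profile w m b t = b + m * t.
Proof.
have /andP[w0 w1] := ww; have w8 := small_width ww; have w88 := small_width8 ww.
rewrite ler_norml => /andP[h1 h2].
have -> : profile w m b t = b + m * zt (8 * w) t + 4 * (m * w) * up w t
  - (speed w + 4 * (m * w)) * down w t by [].
have -> : up w t = 0.
  by rewrite /up !st_eq0 ?subr0//; apply/andP; split; lra.
have -> : down w t = 0.
  by rewrite /down !st_eq1 ?subrr//; apply/andP; split; lra.
rewrite (@zt_id _ _ _ 0)// ?rpred0 ?subr0//; last first.
  by rewrite ler_norml; apply/andP; split; lra.
by rewrite !mulr0 subr0 addr0.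
Qed.

(** Up to 8 w the linear term is large enough. Beyond, the cut-off may bring it back to 0, but it
    stays nonnegative and [up] already contributes 4 m w. *)
Lemma profile_high t : 4 * w <= t <= 2^-1 - w -> b + 4 * (m * w) <= profile w m b t.
Proof.
have /andP[w0 w1] := ww; have w8 := small_width ww; have w88 := small_width8 ww.
move=> /andP[h1 h2]; rewrite /profile.
have -> : down w t = 0.
  by rewrite /down !st_eq1 ?subrr//; apply/andP; split; lra.
have mw0 : 0 < m * w by exact: mulr_gt0.
have /andP[u0 u1] := up_itv t ww.
rewrite mulr0 subr0; case: (leP t (8 * w)) => h3.
  have -> : zt (8 * w) t = t.
    rewrite (@zt_id _ _ _ 0)// ?rpred0 ?subr0//.
    by rewrite ler_norml; apply/andP; split; lra.
  have : 4 * (m * w) <= m * t by rewrite mulrCA ler_pM2l.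
  have : 0 <= 4 * (m * w) * up w t by rewrite mulr_ge0//; lra.
  lra.
have -> : up w t = 1.
  rewrite /up st_eq1// ?st_eq0 ?subr0//; apply/andP; split; lra.
have z0 : 0 <= zt (8 * w) t.
  have [] := @zt_sign _ (8 * w) t; [lra|apply/andP; split; lra|].
  by move=> h _; apply: h; lra.
have : 0 <= m * zt (8 * w) t by rewrite mulr_ge0// ltW.
lra.
Qed.

(** [down] is in transition here, so only the linear term is available. This suffices, because over
    this interval the wave is 0 for every s and the first annulus stays at level [b]. *)
Lemma profile_low_near t : - (6 * w) <= t <= - (4 * w) ->
  profile w m b t <= b - 4 * (m * w).
Proof.
have /andP[w0 w1] := ww; have w8 := small_width ww; have w88 := small_width8 ww.
move=> /andP[h1 h2]; rewrite /profile.
have -> : up w t = 0.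
  by rewrite /up !st_eq0 ?subr0//; apply/andP; split; lra.
have -> : zt (8 * w) t = t.
  rewrite (@zt_id _ _ _ 0)// ?rpred0 ?subr0//.
  by rewrite ler_norml; apply/andP; split; lra.
have mw0 : 0 < m * w by exact: mulr_gt0.
have k0 := speed_gt0 ww.
have /andP[u0 u1] := down_itv t ww.
have : m * t <= m * (- (4 * w)) by rewrite ler_pM2l.
have : 0 <= (speed w + 4 * (m * w)) * down w t by rewrite mulr_ge0//; lra.
rewrite mulr0 addr0; nra.
Qed.

Lemma profile_low t : - 2^-1 + w <= t <= - (6 * w) ->
  profile w m b t <= b - speed w - 4 * (m * w).
Proof.
have /andP[w0 w1] := ww; have w8 := small_width ww; have w88 := small_width8 ww.
move=> /andP[h1 h2]; rewrite /profile.
have -> : up w t = 0.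
  by rewrite /up !st_eq0 ?subr0//; apply/andP; split; lra.
have -> : down w t = 1.
  by rewrite /down st_eq1 ?st_eq0 ?subr0//; apply/andP; split; lra.
have z0 : zt (8 * w) t <= 0.
  have [] := @zt_sign _ (8 * w) t; [lra|apply/andP; split; lra|].
  by move=> _ h; apply: h; lra.
have : m * zt (8 * w) t <= 0 by rewrite mulr_ge0_le0// ltW.
lra.
Qed.

(** 20 = 16 + 4: the cut-off linear term is at most m times 2 (8 w), and [up] or [down] adds 4 m
    w. *)
Lemma profile_bounds t : b - speed w - 20 * (m * w) <= profile w m b t <= b + 20 * (m * w).
Proof.
have /andP[w0 w1] := ww; have w8 := small_width ww;
  have /andP[w80 w88] := small_width8 ww.
rewrite /profile.
have := zt_norm t w80; rewrite ler_norml => /andP[z1 z2].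
have mw0 : 0 < m * w by exact: mulr_gt0.
have k0 := speed_gt0 ww.
have /andP[d0 d1] := down_itv t ww.
have /andP[u0 u1] := up_itv t ww.
have a1 : m * zt (8 * w) t <= m * (2 * (8 * w)) by rewrite ler_pM2l.
have a2 : m * - (2 * (8 * w)) <= m * zt (8 * w) t by rewrite ler_pM2l.
have c0 : 0 < speed w + 4 * (m * w) by lra.
have a3 : 0 <= 4 * (m * w) * up w t by rewrite mulr_ge0//; lra.
have a4 : 4 * (m * w) * up w t <= 4 * (m * w) * 1 by rewrite ler_pM2l//; lra.
have a5 : 0 <= (speed w + 4 * (m * w)) * down w t by rewrite mulr_ge0//; lra.
have a6 : (speed w + 4 * (m * w)) * down w t <= (speed w + 4 * (m * w)) * 1.
  by rewrite ler_pM2l//; lra.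
have e1 : m * (2 * (8 * w)) = 16 * (m * w) by ring.
have e2 : m * - (2 * (8 * w)) = - 16 * (m * w) by ring.
by apply/andP; split; lra.
Qed.

End ProfileValues.

End Profiles.

(** * Vector-valued smoothness and interior minima *)

Section VectorSmooth.
Context {R : realType}.

Lemma continuous_coord m k (f : 'rV[R]_m -> 'rV[R]_k) x :
  (forall i, {for x, continuous (fun y => f y ord0 i)}) -> {for x, continuous f}.
Proof.
move=> fc; rewrite /prop_for /continuous_at;
  apply/(@cvgrPdist_le _ _ _ (nbhs x)) => /= e e0; near=> y.
rewrite /Num.Def.normr/= mx_normrE (bigmax_le _ (ltW e0))//= => -[i j] _ /=.
rewrite !mxE (ord1 i); move: j; near: y; apply: filter_forall => j.
by have /cvgrPdist_le := fc j; apply.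
Unshelve. all: by end_near. Qed.

Lemma smooth_on_coord m k (A : set 'rV[R]_m) (f : 'rV[R]_m -> 'rV[R]_k) :
  open A -> (forall i, smooth A (fun x => f x ord0 i)) -> smooth_on A f.
Proof.
move=> oA fs; split=> // vs.
have vs_s : forall i, smooth A (fun x => iter_deriv f vs x ord0 i).
  elim: vs => [|v vs IH] i //=.
  apply: (@smooth_ext _ _ _ (fun x => 'D_v (fun y => iter_deriv f vs y ord0 i) x)) => //.
    move=> x Ax; rewrite derive_mx ?mxE//; apply/derivable_mxP => a j.
    by rewrite (ord1 a); case: (smooth_is_derive v (IH j) Ax).
  exact: smooth_derive.
split=> x; last by move=> Ax; apply: continuous_coord => i;
  exact: smooth_continuous (vs_s i) Ax.
move=> v Ax; apply/derivable_mxP => a j.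
by rewrite (ord1 a); case: (smooth_is_derive v (vs_s j) Ax).
Qed.

Lemma derive_coord m k (A : set 'rV[R]_m) (f : 'rV[R]_m -> 'rV[R]_k) x v i :
  smooth_on A f -> A x ->
  is_derive x v (fun y => f y ord0 i) ('D_v f x ord0 i).
Proof.
move=> [_ /(_ [::])[/= fd _]] Ax.
have fx := fd x v Ax; rewrite derive_mx// mxE.
by apply: derivableP; exact: ((derivable_mxP _ _ _).1 fx).
Qed.

Lemma line_derivable (V : normedModType R) (g : V -> R) z v t :
  derivable g (t *: v + z) v -> derivable (fun s : R => g (s *: v + z)) t 1.
Proof.
rewrite /derivable; set g1 := fun h => h^-1 *: _; set g2 := fun h => h^-1 *: _.
suff -> : g1 = g2 by [].
apply/funext => h; rewrite /g1 /g2 /= [h *: 1]mulr1.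
by rewrite scalerDl addrA.
Qed.

Lemma line_derive (V : normedModType R) (g : V -> R) z v :
  'D_1 (fun s : R => g (s *: v + z)) 0 = 'D_v g z.
Proof.
rewrite /derive; set g1 := fun h => h^-1 *: _; set g2 := fun h => h^-1 *: _.
suff -> : g1 = g2 by [].
by apply/funext => h; rewrite /g1 /g2 /= addr0 scale0r add0r [h *: 1]mulr1.
Qed.

Lemma derive_local_min (V : normedModType R) (A : set V) (g : V -> R) z v :
  open A -> A z -> (forall y, A y -> derivable g y v) ->
  (forall y, A y -> g z <= g y) -> 'D_v g z = 0.
Proof.
move=> oA Az gd gmin; rewrite -line_derive.
have lc : {for 0, continuous (fun s : R => s *: v + z)}.
  by apply: cvgD; [apply: cvgZr_tmp; exact: cvg_id|exact: cvg_cst].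
have : \forall s \near (0 : R), A (s *: v + z).
  by apply: lc; rewrite scale0r add0r; exact: open_nbhs_nbhs.
move=> /nbhs_ballP[eta /= eta0 hA].
have inA t : t \in `](- eta), eta[%R -> A (t *: v + z).
  rewrite in_itv/= => /andP[h1 h2]; apply: hA.
  by rewrite /ball/= sub0r normrN ltr_norml h1.
apply: (@derive_val _ _ _ _ _ _ _ (@derive1_at_min R _ (- eta) eta 0 _ _ _ _)).
- lra.
- by move=> t /inA At; apply: line_derivable; exact: gd.
- by rewrite in_itv/=; apply/andP; split; lra.
- by move=> t /inA At; rewrite scale0r add0r; exact: gmin.
Qed.

End VectorSmooth.

Local Notation coord := Defs.coord.

(** * Symplectic linear algebra and continuity of the inverse *)

Section Symplectic.
Context {R : realType}.

Lemma coordE m (u : 'rV[R]_m) (i : 'I_m) : coord u i = u ord0 i.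
Proof. by rewrite /coord valK. Qed.

Lemma coord_ge m (u : 'rV[R]_m) k : (m <= k)%N -> coord u k = 0.
Proof. by move=> h; rewrite /coord insubF// ltnNge h. Qed.

Lemma coord_lt m (u : 'rV[R]_m) k (h : (k < m)%N) : coord u k = u ord0 (Ordinal h).
Proof. exact: (coordE u (Ordinal h)). Qed.

Lemma coord0 m k : coord (0 : 'rV[R]_m) k = 0.
Proof.
case: (ltnP k m) => h; last exact: coord_ge.
by rewrite coord_lt mxE.
Qed.

Lemma coordD m (u v : 'rV[R]_m) k : coord (u + v) k = coord u k + coord v k.
Proof.
case: (ltnP k m) => h; last by rewrite !coord_ge// addr0.
by rewrite !coord_lt mxE.
Qed.

Lemma coordZ m c (u : 'rV[R]_m) k : coord (c *: u) k = c * coord u k.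
Proof.
case: (ltnP k m) => h; last by rewrite !coord_ge// mulr0.
by rewrite !coord_lt mxE.
Qed.

Lemma omega0l n (v : 'rV[R]_(2 * n)) : omega 0 v = 0.
Proof. by rewrite /omega big1// => i _; rewrite !coord0 !mul0r subr0. Qed.

Lemma omegaDl n (u u' v : 'rV[R]_(2 * n)) :
  omega (u + u') v = omega u v + omega u' v.
Proof.
by rewrite /omega -big_split; apply: eq_bigr => i _; rewrite !coordD /=; ring.
Qed.

Lemma omegaZl n c (u v : 'rV[R]_(2 * n)) : omega (c *: u) v = c * omega u v.
Proof.
by rewrite /omega big_distrr/=; apply: eq_bigr => i _; rewrite !coordZ; ring.
Qed.

Lemma omega_suml n (I : Type) (r : seq I) (F : I -> 'rV[R]_(2 * n)) v :
  omega (\sum_(i <- r) F i) v = \sum_(i <- r) omega (F i) v.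
Proof.
elim: r => [|i r IH]; first by rewrite !big_nil omega0l.
by rewrite !big_cons omegaDl IH.
Qed.

Lemma omega_nondegenerate n (u : 'rV[R]_(2 * n)) :
  (forall v, omega u v = 0) -> u = 0.
Proof.
move=> h; have cdelta (i : 'I_(2 * n)) k : coord (delta_mx ord0 i) k = (k == i)%:R :> R.
  case: (ltnP k (2 * n)) => hk; first by rewrite (coord_lt _ hk) mxE eqxx.
  by rewrite coord_ge//; case: eqP hk => // ->; rewrite leqNgt ltn_ord.
have even_odd a b : (2 * a == 2 * b + 1)%N = false.
  by apply/eqP => /(congr1 odd); rewrite oddD !oddM.
have cz j : (j < n)%N -> coord u (2 * j) = 0 /\ coord u (2 * j + 1) = 0.
  move=> jn; have j0 : (2 * j < 2 * n)%N by rewrite ltn_mul2l.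
  have j1 : (2 * j + 1 < 2 * n)%N by
    rewrite addn1 -[X in (_ < X)%N]/(2 * n)%N mul2n mul2n ltn_Sdouble.
  have E (v : 'rV[R]_(2 * n)) : omega u v = \sum_(i < n)
     (coord u (2 * i) * coord v (2 * i + 1) - coord u (2 * i + 1) * coord v (2 * i)).
    by rewrite /omega big_mkord.
  split.
    have := h (delta_mx ord0 (Ordinal j1)).
    rewrite E (bigD1 (Ordinal jn))//= big1 => [|i ij]; last first.
      move: ij; rewrite -val_eqE /= => /negbTE ij.
      by rewrite !cdelta /= eqn_add2r eqn_pmul2l// even_odd ij !mulr0 subr0.
    by rewrite !cdelta /= eqxx even_odd mulr1 mulr0 subr0 addr0.
  have := h (delta_mx ord0 (Ordinal j0)).
  rewrite E (bigD1 (Ordinal jn))//= big1 => [|i ij]; last first.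
    move: ij; rewrite -val_eqE /= => /negbTE ij.
    by rewrite !cdelta /= [(_ + 1 == _)%N]eq_sym eqn_pmul2l// even_odd ij !mulr0 subr0.
  rewrite !cdelta /= eqxx [(_ + 1 == _)%N]eq_sym even_odd mulr1 mulr0 sub0r addr0.
  by move/eqP; rewrite oppr_eq0 => /eqP.
apply/rowP => k; rewrite mxE -coordE.
have hk : (k < 2 * n)%N := ltn_ord k.
have k2 : (k./2 < n)%N by rewrite ltn_half_double -mul2n.
have [e0 e1] := cz _ k2.
rewrite -(odd_double_half k) -mul2n addnC; case: (odd k); first exact: e1.
by rewrite addn0.
Qed.

Definition sqnorm m (v : 'rV[R]_m) : R := \sum_(i < m) v ord0 i ^+ 2.

Lemma coord_le_norm m (v : 'rV[R]_m) i : `|v ord0 i| <= `|v|.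
Proof.
rewrite [leRHS]/Num.Def.normr/= mx_normrE.
by apply: le_trans (le_bigmax _ _ (ord0, i)).
Qed.

Lemma sqnorm_le m (v : 'rV[R]_m) : sqnorm v <= m%:R * `|v| ^+ 2.
Proof.
rewrite /sqnorm; apply: (@le_trans _ _ (\sum_(i < m) `|v| ^+ 2)).
  apply: ler_sum => i _; rewrite -real_normK ?num_real//.
  by rewrite ler_sqr ?nnegrE// coord_le_norm.
by rewrite sumr_const card_ord mulr_natl.
Qed.

Lemma norm_le_sqnorm m (v : 'rV[R]_m) : `|v| ^+ 2 <= sqnorm v.
Proof.
have s0 : 0 <= sqnorm v by apply: sumr_ge0 => i _; exact: sqr_ge0.
suff : `|v| <= Num.sqrt (sqnorm v).
  by move=> h; rewrite -(sqr_sqrtr s0) ler_sqr ?nnegrE// sqrtr_ge0.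
rewrite [leLHS]/Num.Def.normr/= mx_normrE bigmax_le ?sqrtr_ge0// => -[i j] _ /=.
rewrite (ord1 i) -sqrtr_sqr ler_wsqrtr// /sqnorm (bigD1 j)//= lerDl.
by apply: sumr_ge0 => k _; exact: sqr_ge0.
Qed.


(** If f y is close to f x, the minimum of |f z - f y|^2 over a small closed ball about x is
    attained in the interior, so its gradient vanishes there. The differential is invertible because
    omega is nondegenerate, hence f z = f y, and injectivity puts y itself in the ball. *)
Lemma symplectic_inverse_continuous n (A : set 'rV[R]_(2 * n))
    (f : 'rV[R]_(2 * n) -> 'rV[R]_(2 * n)) :
  smooth_on A f -> {in A &, injective f} ->
  (forall x u v, A x -> omega (derive f x u) (derive f x v) = omega u v) ->
  forall x, A x -> forall e : R, 0 < e -> exists2 d : R, 0 < d &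
    forall y, A y -> `|f y - f x| < d -> `|y - x| < e.
Proof.
move=> fs finj fom x Ax e e0; have oA := fs.1.
have fc y : A y -> {for y, continuous f}.
  by move=> Ay; have [_ /(_ [::])[_]] := fs; exact.
have : nbhs x A by exact: open_nbhs_nbhs.
move=> /nbhs_ballP[r0 /= r00 hr0].
have [r [r_gt0 r_lt0 r_lte]] : exists r, [/\ 0 < r, r < r0 & r < e].
  exists (Num.min r0 e / 2); split; first by rewrite divr_gt0// lt_min r00.
    rewrite ltr_pdivrMr//; apply: (@le_lt_trans _ _ r0); last lra.
    by rewrite ge_min lexx.
  rewrite ltr_pdivrMr//; apply: (@le_lt_trans _ _ e); last lra.
  by rewrite ge_min lexx orbT.
pose K := [set y : 'rV[R]_(2 * n) | `|y - x| <= r].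
pose S := [set y : 'rV[R]_(2 * n) | `|y - x| = r].
have KA : K `<=` A.
  by move=> y Ky; apply: hr0; rewrite -ball_normE /= distrC (le_lt_trans Ky).
have nc (z : 'rV[R]_(2 * n)) : continuous (fun y : 'rV[R]_(2 * n) => `|y - z|).
  by move=> y; apply: (@cvg_norm _ _ _ (nbhs y)); apply: (@cvgB _ _ _ (nbhs y));
    [exact: cvg_id|exact: cvg_cst].
have Kc : compact K.
  apply: bounded_closed_compact.
    exists (`|x| + r); split; first exact: num_real.
    move=> M hM y /= Ky; apply: le_trans (ltW hM).
    by rewrite -[y](subrK x) (le_trans (ler_normD _ _))// addrC lerD2l.
  exact: (closed_comp (fun y _ => nc x y) (@closed_le _ r)).
have Sc : compact S.
  apply: (subclosed_compact _ Kc); last by move=> y Sy; rewrite /K /= Sy.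
  exact: (closed_comp (fun y _ => nc x y) (@closed_eq _ r)).
have [c c0 hc] : exists2 c, 0 < c & forall y, S y -> c <= `|f y - f x|.
  have [S0|S0] := pselect (S !=set0); last first.
    by exists 1 => // y Sy; exfalso; apply: S0; exists y.
  have cf : {within S, continuous (fun y => `|f y - f x|)}.
    apply: continuous_in_subspaceT => y /set_mem Sy.
    apply: (@continuous_comp _ _ _ f (fun z => `|z - f x|)); last exact: nc.
    by apply: fc; apply: KA; rewrite /K /= Sy.
  have [y0 /set_mem Sy0 hy0] := compact_EVT_min S0 Sc cf.
  exists (`|f y0 - f x|); last by move=> y /mem_set /hy0.
  rewrite normr_gt0 subr_eq0; apply/eqP => fE.
  have y0x : y0 = x.
    by apply: finj fE; apply: mem_set => //; apply: KA; rewrite /K /= Sy0.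
  by move: Sy0; rewrite /S /= y0x subrr normr0 => r0E; rewrite -r0E ltxx in r_gt0.
pose m := (2 * n)%N.
(* On the sphere the sup norm of f z - f y is at least c - d = (m + 1) d, so its Euclidean square is
   at least (m + 1)^2 d^2, against at most m d^2 at the centre. *)
pose d := c / (m%:R + 2).
have m2 : 0 < m%:R + 2 :> R by rewrite ltr_wpDl.
have d0 : 0 < d by rewrite divr_gt0.
exists d => // y Ay hy.
pose g (z : 'rV[R]_(2 * n)) := sqnorm (f z - f y).
have fcoord i : forall z, A z -> {for z, continuous (fun z => f z ord0 i)}.
  move=> z Az; apply: (@continuous_comp _ _ _ f (fun M : 'rV[R]_(2 * n) => M ord0 i)).
    exact: fc.
  exact: coord_continuous.
have gd z v : A z -> is_derive z v g
    (\sum_(i < 2 * n) 2 * (f z ord0 i - f y ord0 i) * 'D_v f z ord0 i).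
  move=> Az.
  have -> : g = \sum_(i < 2 * n) (fun z => (f z ord0 i - f y ord0 i) ^+ 2).
    apply/funext => z'; rewrite /g /sqnorm fct_sumE.
    by apply: eq_bigr => i _; rewrite !mxE.
  apply: is_derive_sum => i.
  have dB : is_derive z v (fun z => f z ord0 i - f y ord0 i) ('D_v f z ord0 i - 0).
    by apply: is_deriveB; exact: derive_coord fs Az.
  by apply: is_derive_eq (is_derive_pow 2 dB) _; rewrite subr0 expr1.
have gK : {within K, continuous g}.
  have g0 : Ck 0 A g.
    rewrite /g /sqnorm; apply: Ck_sum => i.
    have h : Ck 0 A (fun z => (f z - f y) ord0 i).
      under eq_fun do rewrite mxE.
      by apply: CkD; [split=> // z; exact: fcoord|exact: Ck_cst].
    by under eq_fun do rewrite expr2; exact: CkM.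
  apply: continuous_in_subspaceT => z /set_mem /KA; exact: Ck_continuous g0.
have K0 : K !=set0 by exists x; rewrite /K /= subrr normr0 ltW.
have [z0 /set_mem Kz0 hz0] := compact_EVT_min K0 Kc gK.
have Az0 := KA _ Kz0.
have z0r : `|z0 - x| < r.
  rewrite lt_neqAle; apply/andP; split; last exact: Kz0.
  apply/eqP => Sz0.
  have h1 : g z0 <= g x by apply: hz0; apply: mem_set; rewrite /K /= subrr normr0 ltW.
  have h2 : g x < m%:R * d ^+ 2 + d ^+ 2.
    apply: (@le_lt_trans _ _ (m%:R * d ^+ 2)); last by rewrite ltrDl exprn_gt0.
    apply: le_trans (sqnorm_le _) _; apply: ler_wpM2l => //.
    by rewrite ler_sqr ?nnegrE ?(ltW d0)// distrC ltW.
  have h3 : ((m%:R + 1) * d) ^+ 2 <= g z0.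
    apply: le_trans _ (norm_le_sqnorm _).
    have dm0 : 0 <= (m%:R + 1) * d by apply: mulr_ge0; [exact: addr_ge0|exact: ltW].
    rewrite ler_sqr ?nnegrE//.
    have := hc _ Sz0.
    have -> : c = (m%:R + 2) * d by rewrite /d mulrC divfK// gt_eqF.
    have : `|f z0 - f x| <= `|f z0 - f y| + `|f y - f x|.
      by rewrite -[f z0 - f x](subrKA (f y)) ler_normD.
    move: hy; rewrite !mulrDl; lra.
  have : (m%:R + 1) * d ^+ 2 <= ((m%:R + 1) * d) ^+ 2.
    rewrite -subr_ge0.
    have -> : ((m%:R + 1) * d) ^+ 2 - (m%:R + 1) * d ^+ 2
      = m%:R * (m%:R + 1) * d ^+ 2 by ring.
    by rewrite mulr_ge0 ?exprn_ge0 ?(ltW d0)// mulr_ge0 ?addr_ge0.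
  move: h1 h2 h3; rewrite mulrDl mul1r; lra.
have Dz0 v : \sum_(i < 2 * n) 2 * (f z0 ord0 i - f y ord0 i) * 'D_v f z0 ord0 i = 0.
  have [_ <-] := gd z0 v Az0.
  apply: (@derive_local_min _ _ [set z | `|z - x| < r]) => //.
  - exact: (open_comp (fun y _ => nc x y) (@open_lt _ r)).
  - by move=> z zr; have [] := gd z v (KA _ (ltW zr)).
  - by move=> z zr; apply: hz0; apply: mem_set; exact: ltW.
pose D (j : 'I_(2 * n)) : 'rV[R]_(2 * n) := 'D_(delta_mx ord0 j) f z0.
pose B := \matrix_(j < 2 * n) D j.
(* If w B = 0, bilinearity of omega gives omega w v = omega (w B) (D_v f) = 0 for every v. *)
have rB : row_free B.
  rewrite -kermx_eq0; apply/rowV0P => w; rewrite sub_kermx => /eqP wB.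
  apply: omega_nondegenerate => v.
  have DwB : \sum_j w ord0 j *: D j = w *m B.
    by rewrite mulmx_sum_row; apply: eq_bigr => j _; rewrite rowK.
  have -> : omega w v = omega (w *m B) ('D_v f z0); last by rewrite wB omega0l.
  rewrite -DwB omega_suml {1}[w]row_sum_delta omega_suml.
  by apply: eq_bigr => j _; rewrite !omegaZl -(fom z0).
have fz0y : f z0 = f y.
  apply/eqP; rewrite -subr_eq0 -trmx_eq0; apply/eqP.
  have Bu : B \in unitmx by rewrite -row_free_unit.
  rewrite -[LHS](mulKmx Bu); suff -> : B *m (f z0 - f y)^T = 0 by rewrite mulmx0.
  apply/colP => j; rewrite !mxE.
  apply: (@mulfI _ 2) => //; rewrite mulr0 -[RHS](Dz0 (delta_mx ord0 j)).
  by rewrite big_distrr /=; apply: eq_bigr => i _; rewrite !mxE; ring.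
have <- : z0 = y by apply: finj fz0y; exact: mem_set.
exact: lt_trans r_lte.
Qed.

End Symplectic.

(** * The symplectic map in strip and action-angle coordinates *)

Section MiddleMap.
Context {R : realType}.
Implicit Types (w m b c k S q s u v X Y z : R).

(** On the first annulus theta = v + u / m, so this is the argument theta - s / k of the travelling
    wave. *)
Definition phase w m s u v : R := v + u / m - s / speed w.
(** Symplectic partner of the shift in [mid_gamma]: one Hamiltonian, proportional to Y [st w v],
    moves X by -2 S [st w v] and u by -(2 S / pi) Y [dst w v]; the pi is there because (u, v)
    carries the form pi du dv. *)
Definition slide w S u v Y : R := u - 2 * S / pi * Y * dst w v.
Definition midQ w m q s u v : R := q + wave w (phase w m s u v).
Definition mid_theta w m S u v Y : R := v + slide w S u v Y / m.
(** One formula for both annuli; let n = [nint v]. If |v - n| < w, the wave is 0 and rho =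
    profile(theta) - m (v - n): the second annulus, with v as transverse coordinate. If |v - n| >=
    w, then [slide] is u, the profile is in its linear range, the two [zt] terms cancel and rho = b
    + u - k wave: the first annulus. *)
Definition mid_rho w m b S s u v Y : R :=
  profile w m b (slide w S u v Y / m + zt w v) - m * zt w v
  - speed w * wave w (phase w m s u v).
Definition mid_gamma w S v X : R := X - 2 * S * st w v.

Lemma nint_eq v z : z \is a Num.int -> `|v - z| < 2^-1 -> nint v = z.
Proof.
move=> zi h; have h' : `|v - z| <= 3/4 by rewrite (le_trans (ltW h))//; lra.
move: h; rewrite ltr_norml => /andP[h1 h2].
by have [//|[_ h3]|[_ h3]] := nint_near zi h'; lra.
Qed.

Lemma int_lt1_eq0 z : z \is a Num.int -> `|z| < 1 -> z = 0.
Proof.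
move=> zi h; have := norm_intr_ge1 zi; case: eqP => // _ /(_ isT).
by rewrite leNgt h.
Qed.

Section Fixed.
Variables (w m b S : R).
Hypotheses (ww : 0 < w <= 100^-1) (m1 : 1 <= m) (S0 : 0 < S).

Let w0 : 0 < w. Proof. by case/andP: ww. Qed.
Let w1 : w <= 100^-1. Proof. by case/andP: ww. Qed.
Let m0 : 0 < m. Proof. by rewrite (lt_le_trans _ m1). Qed.
Let mw0 : 0 < m * w. Proof. exact: mulr_gt0. Qed.

Lemma div_speed s : 0 < s < 1 -> 0 < s / speed w < 2^-1 - 15 * w.
Proof.
move=> /andP[s0 s1]; have k0 := speed_gt0 ww; rewrite -(speedV ww) divr_gt0//=.
by rewrite gtr_pMl; [|rewrite invr_gt0].
Qed.

Lemma div_slope u : `|u| < m * w -> - w < u / m < w.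
Proof.
move=> hu; have : `|u / m| < w by rewrite norm_div_pos// ltr_pdivrMr// mulrC.
by rewrite ltr_norml.
Qed.

Lemma wave_near0 y z : z \is a Num.int ->
  - 2^-1 + 17 / 2 * w < y - z < 15 / 2 * w -> \forall t \near y, wave w t = 0.
Proof.
move=> zi /andP[h1 h2]; near=> t.
rewrite -(subrK z t) waveDz// wave_eq0//; apply/andP; split; apply: ltW.
  by rewrite ltrBrDr; near: t; apply: lt_nbhsr; lra.
by rewrite ltrBlDr; near: t; apply: lt_nbhsl; lra.
Unshelve. all: by end_near. Qed.

Lemma wave_in_near0 s u v : 0 < s < 1 -> `|u| < m * w -> `|v - nint v| < w ->
  \forall t \near phase w m s u v, wave w t = 0.
Proof.
move=> hs hu hv; apply: (wave_near0 (nint_int v)); rewrite /phase.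
have /andP[] := div_speed hs; have /andP[] := div_slope hu.
move: hv; rewrite ltr_norml => /andP[].
have := w0; have := w1; move: (nint v) (s / _) (u / m) => N a c *.
by apply/andP; split; lra.
Qed.

Lemma mid_in s u v Y : 0 < s < 1 -> `|u| < m * w -> `|v - nint v| < w ->
  wave w (phase w m s u v) = 0 /\
  mid_rho w m b S s u v Y =
    profile w m b (mid_theta w m S u v Y) - m * (v - nint v).
Proof.
move=> hs hu hv; have hw0 := nbhs_singleton (wave_in_near0 hs hu hv).
split=> //; rewrite /mid_rho hw0 mulr0 subr0 (zt_id (small_width ww) (nint_int v));
  last exact: ltW.
have -> : slide w S u v Y / m + (v - nint v)
  = mid_theta w m S u v Y + - nint v by rewrite /mid_theta; ring.
by rewrite profileDz ?rpredN ?nint_int.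
Qed.

Lemma zt_slope_small u v : `|u| < m * w -> `|u / m + zt w v| < 3 * w.
Proof.
move=> /div_slope /andP[h1 h2]; have := zt_norm v w0.
rewrite ler_norml => /andP[h3 h4]; rewrite ltr_norml; apply/andP; split; lra.
Qed.

Lemma mid_out s u v Y : `|u| < m * w -> w <= `|v - nint v| ->
  [/\ dst w v = 0, slide w S u v Y = u &
      mid_rho w m b S s u v Y = b + u - speed w * wave w (phase w m s u v)].
Proof.
move=> hu hv; have hd := nbhs_singleton (dst_near0 (small_width ww) hv).
have hs : slide w S u v Y = u by rewrite /slide hd mulr0 subr0.
split=> //; rewrite /mid_rho hs profile_linear//; last first.
  by rewrite (le_trans (ltW (zt_slope_small v hu)))//; have := w0; lra.
have -> : m * (u / m + zt w v) = u + m * zt w v.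
  by rewrite mulrDr mulrCA divff ?mulr1// gt_eqF.
by ring.
Qed.

(** A displacement G of q saves k G >= G in rho, so it never increases the sum. 21 is the 20 of
    [profile_bounds] plus 1 for the half-thickness of the annulus. *)
Lemma mid_bounds q s u v Y : 0 < q < 1 -> 0 < s < 1 -> `|u| < m * w ->
  [/\ 0 < midQ w m q s u v,
      b - speed w - 21 * (m * w) <= mid_rho w m b S s u v Y &
      midQ w m q s u v + mid_rho w m b S s u v Y < 1 + b + 21 * (m * w)].
Proof.
move=> /andP[q0 q1] hs hu; have mwp := mw0.
have /andP[g0 g1] := wave_itv (phase w m s u v) ww.
have k1 := speed_ge1 ww.
case: (ltP `|v - nint v| w) => hv.
  have [e ->] := mid_in Y hs hu hv; rewrite /midQ e addr0.
  have /andP[p1 p2] := profile_bounds b ww m0 (mid_theta w m S u v Y).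
  have : `|m * (v - nint v)| < m * w by rewrite normrM (gtr0_norm m0) ltr_pM2l.
  rewrite ltr_norml => /andP[h1 h2].
  by split; lra.
have [_ _ ->] := mid_out s Y hu hv; rewrite /midQ.
move: hu; rewrite ltr_norml => /andP[h1 h2].
have a1 : speed w * wave w (phase w m s u v) <= speed w * 1.
  by apply: ler_wpM2l => //; lra.
have a2 : wave w (phase w m s u v) <= speed w * wave w (phase w m s u v).
  by rewrite ler_peMl.
by split; lra.
Qed.

(** The closing dichotomy is all that symplecticity asks of the profiles: in the plumbing the wave
    is stationary and [zt] has slope 1; elsewhere the staircase is flat to second order and the
    profile has slope m. *)
Lemma mid_derivatives s u v Y : 0 < s < 1 -> `|u| < m * w ->
  exists W H H1 P Z : R,
  [/\ is_derive (phase w m s u v) 1 (wave w) W,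
      is_derive v 1 (st w) H, is_derive v 1 (dst w) H1,
      is_derive (slide w S u v Y / m + zt w v) 1 (profile w m b) P &
      is_derive v 1 (zt w) Z] /\
  H = dst w v /\ (W = 0 /\ Z = 1 \/ [/\ H = 0, H1 = 0 & P = m]).
Proof.
move=> hs hu; have w8 := small_width ww; have w88 := small_width8 ww.
have smooth_wave : smooth setT (wave w).
  apply: smoothB; apply: smooth_st => //; try exact: smooth_cst; try exact: openT.
    by apply: smoothB; [exact: smooth_id|exact: smooth_cst].
  by do 2?[apply: smoothB]; [exact: smooth_id|exact: smooth_cst..].
have smooth_shift c : smooth setT (fun t : R => st w (t + c)).
  apply: smooth_st => //; [exact: openT| |exact: smooth_cst].
  by apply: smoothD; [exact: smooth_id|exact: smooth_cst].
have smooth_profile : smooth setT (profile w m b).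
  apply: smoothB.
    apply: smoothD; last by apply: smoothM; [exact: smooth_cst|exact: smoothB].
    apply: smoothD; first exact: smooth_cst.
    apply: smoothM; first exact: smooth_cst.
    by apply: smooth_zt => //; [exact: openT|exact: smooth_id|exact: smooth_cst].
  by apply: smoothM; [exact: smooth_cst|exact: smoothB].
have smooth_dstw : smooth setT (dst w).
  by apply: smooth_dst => //; [exact: openT|exact: smooth_id|exact: smooth_cst].
have smooth_ztw : smooth setT (zt w).
  by apply: smooth_zt => //; [exact: openT|exact: smooth_id|exact: smooth_cst].
case: (ltP `|v - nint v| w) => hv.
  exists 0, (dst w v), ('D_1 (dst w) v),
    ('D_1 (profile w m b) (slide w S u v Y / m + zt w v)), 1.
  split; [split|by split=> //; left].
  - by apply: (derive_const_near (c := 0)); exact: wave_in_near0.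
  - exact: is_derive_st.
  - exact: (smooth_is_derive (x := v) 1 smooth_dstw I).
  - exact: (smooth_is_derive (x := slide w S u v Y / m + zt w v) 1 smooth_profile I).
  - apply: (@near_eq_is_derive _ _ _ (fun t => t - nint v)).
      apply: filterS (zt_near w8 (nint_int v) (ltW hv)) => t /= ->//.
    by rewrite -[X in is_derive _ _ _ X]subr0; apply: is_deriveB.
have near0 := dst_near0 w8 hv.
exists ('D_1 (wave w) (phase w m s u v)), 0, 0, m, ('D_1 (zt w) v).
have d0 := nbhs_singleton near0.
split; [split|by split=> //; right].
- exact: (smooth_is_derive (x := phase w m s u v) 1 smooth_wave I).
- by rewrite -d0; exact: is_derive_st.
- exact: derive_const_near near0.
- have [_ -> _] := mid_out s Y hu hv.
  have := zt_slope_small v hu; move: (u / m + zt w v) => t0.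
  rewrite ltr_norml => /andP[h1 h2].
  apply: (@near_eq_is_derive _ _ _ (fun t => b + m * t)).
    near=> t; rewrite profile_linear// ler_norml; have wp := w0.
    apply/andP; split; apply: ltW; near: t; [apply: lt_nbhsr|apply: lt_nbhsl]; lra.
  have dm := is_derive_scale m (is_derive_id t0 (1 : R)).
  by apply: is_derive_eq (is_deriveD (is_derive_cst b t0 1) dm) _; rewrite add0r mulr1.
- exact: (smooth_is_derive (x := v) 1 smooth_ztw I).
Unshelve. all: by end_near. Qed.

End Fixed.

(* The two annuli, seen in the second factor, meet over the same point of the
   first factor only where they are plumbed together. *)
Lemma wave_profile_cross w m b s t a u : 0 < w <= 100^-1 -> 0 < m -> 0 < s < 1 ->
  - 2^-1 <= t < 2^-1 ->
  `|a| < m * w -> `|u| < m * w -> wave w (t - s / speed w) < 1 ->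
  profile w m b t - a = b + u - speed w * wave w (t - s / speed w) ->
  m * t = a + u.
Proof.
move=> ww m0 /(div_speed ww) /andP[sk0 sk1] /andP[t1 t2]; have /andP[wp wl] := ww.
rewrite !ltr_norml => /andP[a1 a2] /andP[u1 u2] g1 e.
have /andP[g0 _] := wave_itv (t - s / speed w) ww.
have k1 := speed_ge1 ww.
set g := wave _ _ in g0 g1 e.
have kg0 : 0 <= speed w * g by apply: mulr_ge0 => //; clear -k1; lra.
have kg1 : speed w * g <= speed w * 1.
  by apply: ler_wpM2l; [clear -k1; lra|exact: ltW].
(* Around half a turn the wave is 1 whatever s is, against the assumption that it is below 1; the
   same happens at the other end, t < -1/2 + w. This is the crossing where the disc is moved off
   itself. *)
have [c1|c1] := ltP (2^-1 - w) t.
  suff : g = 1 by clear -g1; lra.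
  by rewrite /g wave_eq1//; apply/andP; split; clear -wp wl sk0 sk1 t1 t2 c1; lra.
have [c2|c2] := ltP (4 * w) t.
  have h : b + 4 * (m * w) <= profile w m b t.
    by apply: profile_high => //; rewrite (ltW c2) c1.
  by exfalso; clear -h e a1 a2 u1 u2 kg0; lra.
have [c3|c3] := ltP t (- 2^-1 + w).
  suff : g = 1 by clear -g1; lra.
  have -> : g = wave w (t - s / speed w + 1) by rewrite waveDz ?rpred1.
  by rewrite wave_eq1//; apply/andP; split; clear -wp wl sk0 sk1 t1 t2 c3; lra.
have [c4|c4] := ltP t (- (6 * w)).
  have h : profile w m b t <= b - speed w - 4 * (m * w).
    by apply: profile_low => //; rewrite c3 (ltW c4).
  by exfalso; clear -h e a1 a2 u1 u2 kg1; lra.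
(* On the remaining interval [-6 w, 4 w] the wave is 0 for every s, by the margin built into
   [speed]. *)
have g00 : g = 0.
  by rewrite /g wave_eq0//; apply/andP; split; clear -wp wl sk0 sk1 c2 c4; lra.
move: e; rewrite g00 mulr0 subr0 => e.
have [c5|c5] := ltP t (- (4 * w)).
  have h : profile w m b t <= b - 4 * (m * w).
    by apply: profile_low_near => //; rewrite c4 (ltW c5).
  by exfalso; clear -h e a1 a2 u1 u2; lra.
move: e; rewrite profile_linear//; last by rewrite ler_norml c5 c2.
by clear; lra.
Qed.

(** A common point would lie on the crossing at the plumbing, where v' equals v - nint v up to an
    integer; then v' would itself be within w of an integer. *)
Lemma mid_disjoint w m b S q q' s u u' v v' Y Y' j :
  0 < w <= 100^-1 -> 1 <= m ->
  0 < q < 1 -> 0 < q' < 1 -> 0 < s < 1 -> `|u| < m * w -> `|u'| < m * w ->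
  j \is a Num.int -> `|v - nint v| < w -> w <= `|v' - nint v'| ->
  midQ w m q s u v = midQ w m q' s u' v' ->
  mid_rho w m b S s u v Y = mid_rho w m b S s u' v' Y' ->
  mid_theta w m S u' v' Y' = mid_theta w m S u v Y + j -> False.
Proof.
move=> ww m1 /andP[_ q1] /andP[q'0 _] hs hu hu' ji hv hv'.
have m0 : 0 < m := lt_le_trans ltr01 m1; have /andP[w0 w1] := ww.
have [e1 ->] := mid_in b S ww m1 Y hs hu hv.
have [_ sl ->] := mid_out b S ww m1 s Y' hu' hv'.
rewrite /midQ e1 addr0; move: (mid_theta w m S u v Y) => th eQ eR.
rewrite /mid_theta sl => eT.
have Ni := nint_int th; have := nint_itv th; set N := nint th in Ni * => /andP[t1 t2].
have gE : wave w (phase w m s u' v') = wave w (th - N - s / speed w).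
  have -> : phase w m s u' v' = th - N - s / speed w + (N + j).
    by rewrite /phase eT; ring.
  by rewrite waveDz// rpredD.
have pE : profile w m b th = profile w m b (th - N) by
  rewrite -(profileDz w m b (th - N) Ni) subrK.
have tE : m * (th - N) = m * (v - nint v) + u'.
  apply: (@wave_profile_cross w m b s) => //.
  - by apply/andP; split; clear -t1 t2; lra.
  - by rewrite normrM (gtr0_norm m0) ltr_pM2l.
  (* q = q' + wave with q < 1 and q' > 0 keeps the wave below 1: equality of the first factors rules
     out the crossing at half a turn. *)
  - by rewrite -gE; clear -eQ q1 q'0; lra.
  - by rewrite -gE -pE.
have v'E : v' = v - nint v + (N + j).
  have -> : v' = th - N - u' / m + (N + j).
    by rewrite -[v'](addrK (u' / m)) eT; ring.
  congr (_ + _); apply: (mulfI (lt0r_neq0 m0)).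
  have -> : m * (th - N - u' / m) = m * (th - N) - u' by field; rewrite gt_eqF.
  by rewrite tE addrK.
have nv' : nint v' = N + j.
  apply: nint_eq; first by rewrite rpredD.
  by rewrite v'E addrK (lt_trans hv)//; clear -w1; lra.
by move: hv'; rewrite nv' v'E addrK leNgt hv.
Qed.

Lemma mid_injective w m b S q q' s u u' v v' X X' Y j :
  0 < w <= 100^-1 -> 1 <= m -> 0 < S ->
  0 < q < 1 -> 0 < q' < 1 -> 0 < s < 1 -> `|u| < m * w -> `|u'| < m * w ->
  `|X - X'| < 2 * S -> j \is a Num.int ->
  midQ w m q s u v = midQ w m q' s u' v' ->
  mid_rho w m b S s u v Y = mid_rho w m b S s u' v' Y ->
  mid_theta w m S u' v' Y = mid_theta w m S u v Y + j ->
  mid_gamma w S v X = mid_gamma w S v' X' ->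
  [/\ q = q', u = u', v = v' & X = X'].
Proof.
move=> ww m1 S0 hq hq' hs hu hu' hX ji eQ eR eT eG.
have m0 : 0 < m := lt_le_trans ltr01 m1; have /andP[w0 w1] := ww.
(* Points that are z turns apart differ by 2 S |z| in X, which is too much unless z = 0. *)
have shift_v z : z \is a Num.int -> v' = v + z -> v = v' /\ X = X'.
  move=> zi v'E; have E : X - X' = - (2 * S * z).
    move: eG; rewrite /mid_gamma v'E stDz//; move: (st w v) => a.
    by clear; lra.
  have z0 : z = 0.
    apply: int_lt1_eq0 => //; move: hX; rewrite E normrN normrM gtr0_norm ?mulr_gt0//.
    by rewrite gtr_pMr ?mulr_gt0.
  rewrite v'E z0 addr0; split=> //; apply/eqP.
  by rewrite -subr_eq0 E z0 mulr0 oppr0.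
case: (ltP `|v - nint v| w) => hv; case: (ltP `|v' - nint v'| w) => hv'.
- have [e1 e2] := mid_in b S ww m1 Y hs hu hv;
  have [e3 e4] := mid_in b S ww m1 Y hs hu' hv'.
  have qq : q = q' by move: eQ; rewrite /midQ e1 e3 !addr0.
  have vv : v - nint v = v' - nint v'.
    apply: (mulfI (lt0r_neq0 m0)); move: eR; rewrite e2 e4 eT profileDz//.
    by move=> /addrI /oppr_inj.
  have [] := shift_v (nint v' - nint v); first by rewrite rpredB ?nint_int.
    by apply: (addIr (- nint v')); rewrite -vv; ring.
  move=> vE XE; split=> //; rewrite -vE in eT.
  have mn0 : m != 0 by rewrite gt_eqF.
  have div_sub (a a' : R) : a' / m = a / m + j -> a' - a = m * j.
    by move=> h; rewrite -[a'](divfK mn0) h; field.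
  have uj : u' - u = m * j.
    rewrite -(@div_sub (slide w S u v Y) (slide w S u' v Y)).
      by rewrite /slide; ring.
    by move: eT; rewrite /mid_theta -addrA => /addrI.
  suff j0 : j = 0 by apply/esym/eqP; rewrite -subr_eq0 uj j0 mulr0.
  apply: int_lt1_eq0 => //; have : `|m * j| < m * 1.
    rewrite mulr1 -uj; move: hu hu'; rewrite !ltr_norml => /andP[a1 a2] /andP[a3 a4].
    have c1 : m * w <= m * 100^-1 by rewrite ler_pM2l.
    by apply/andP; split; clear -a1 a2 a3 a4 c1 m0; lra.
  by rewrite normrM (gtr0_norm m0) ltr_pM2l.
- by exfalso; apply: (mid_disjoint ww m1 hq hq' hs hu hu' ji hv hv' eQ eR eT).
- exfalso; apply: (@mid_disjoint w m b S q' q s u' u v' v Y Y (- j)) => //;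
  first by rewrite rpredN.
  by rewrite eT addrK.
- have [_ s1 e1] := mid_out b S ww m1 s Y hu hv;
  have [_ s2 e2] := mid_out b S ww m1 s Y hu' hv'.
  move: eT; rewrite /mid_theta s1 s2 => eT.
  have gE : wave w (phase w m s u' v') = wave w (phase w m s u v).
    have -> : phase w m s u' v' = phase w m s u v + j by rewrite /phase eT; ring.
    by rewrite waveDz.
  have uu : u = u' by move: eR; rewrite e1 e2 gE => /addIr /addrI.
  have [] := shift_v j ji.
    by rewrite -[v'](addrK (u' / m)) eT uu; ring.
  by move=> vE XE; split=> //; move: eQ; rewrite /midQ gE => /addIr.
Qed.

End MiddleMap.

(** * Area coordinates on the unit disc, and polar coordinates *)

Section AreaCoordinates.
Context {R : realType}.
Implicit Types (x y t Q : R).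

(* Signed area of the part of the unit disc between the vertical lines through
   0 and x: it straightens the disc to a rectangle. *)
Definition disc_area x : R := x * Num.sqrt (1 - x ^+ 2) + asin x.
Definition chord x : R := 2 * Num.sqrt (1 - x ^+ 2).

Lemma one_sub_sqr_gt0 x : `|x| < 1 -> 0 < 1 - x ^+ 2.
Proof.
move=> h; rewrite subr_gt0 -real_normK ?num_real// expr_lt1//.
Qed.

Lemma chord_gt0 x : `|x| < 1 -> 0 < chord x.
Proof. by move=> h; rewrite mulr_gt0// sqrtr_gt0 one_sub_sqr_gt0. Qed.

Lemma is_derive_disc_area x : `|x| < 1 -> is_derive x 1 disc_area (chord x).
Proof.
move=> h; have d0 := one_sub_sqr_gt0 h.
have dX : is_derive x 1 (fun y : R => 1 - y ^+ 2) (0 - 2%:R * x ^+ 1 * 1).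
  by apply: is_deriveB; exact: is_derive_pow.
have dS := @is_derive_chain _ _ Num.sqrt (fun y : R => 1 - y ^+ 2) x 1 _ _
  (is_derive1_sqrt d0) dX.
have dM := is_derive_mul (is_derive_id x (1 : R)) dS.
have hx : -1 < x < 1 by rewrite -ltr_norml.
apply: is_derive_eq (is_deriveD dM (is_derive1_asin hx)) _.
rewrite /chord /=; have s0 : Num.sqrt (1 - x ^+ 2) != 0 by rewrite gt_eqF ?sqrtr_gt0.
rewrite [RHS](_ : _
  = Num.sqrt (1 - x ^+ 2) + (Num.sqrt (1 - x ^+ 2)) ^+ 2 / Num.sqrt (1 - x ^+ 2));
    last by field.
rewrite sqr_sqrtr ?ltW//; field.
by rewrite s0.
Qed.

Lemma open_norm_lt1 : open [set x : R | `|x| < 1].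
Proof.
have -> : [set x : R | `|x| < 1] = [set x | -1 < x] `&` [set x | x < 1].
  by apply/seteqP; split=> x /=; rewrite ltr_norml => /andP.
by apply: openI; [exact: open_gt|exact: open_lt].
Qed.

Lemma smooth_chord : smooth [set x : R | `|x| < 1] chord.
Proof.
apply: smoothM; first exact: smooth_cst.
apply: smooth_sqrt; last by move=> x; exact: one_sub_sqr_gt0.
apply: smoothB; first exact: smooth_cst.
by apply: smoothM; exact: smooth_id.
Qed.

Lemma smooth_disc_area : smooth [set x : R | `|x| < 1] disc_area.
Proof. exact: (smooth_primitive is_derive_disc_area smooth_chord). Qed.

Lemma disc_area_lt x y : `|x| < 1 -> `|y| < 1 -> x < y -> disc_area x < disc_area y.
Proof.
move=> hx hy xy.
have inI c : c \in `[x, y]%R -> `|c| < 1.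
  rewrite in_itv/= => /andP[c1 c2]; move: hx hy; rewrite !ltr_norml.
  by move=> /andP[a1 a2] /andP[b1 b2]; apply/andP; split; lra.
have [||c cxy E] := @MVT R disc_area chord x y xy.
- by move=> c cxy; apply: is_derive_disc_area; apply: inI; exact: subset_itv_oo_cc cxy.
- apply: derivable_within_continuous => c cxy.
  by have [] := is_derive_disc_area (inI _ cxy).
- rewrite -subr_gt0 E mulr_gt0 ?subr_gt0// chord_gt0//.
  by apply: inI; exact: subset_itv_oo_cc cxy.
Qed.

Lemma disc_area_inj x y : `|x| < 1 -> `|y| < 1 -> disc_area x = disc_area y -> x = y.
Proof.
move=> hx hy e; case: (ltgtP x y) => // h.
  by have := disc_area_lt hx hy h; rewrite e ltxx.
by have := disc_area_lt hy hx h; rewrite e ltxx.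
Qed.

Lemma sin_le_id t : 0 <= t -> sin t <= t.
Proof.
rewrite le_eqVlt => /predU1P[<-|t0]; first by rewrite sin0.
have [|c ct E] := @MVT R sin cos 0 t t0.
- by apply: derivable_within_continuous => c _; exact: derivable_sin.
- by move: E; rewrite sin0 !subr0 => ->; rewrite ler_piMl ?cos_le1// ltW.
Qed.

(** sqrt (1 - y^2) is the sine of pi/2 - asin y and of pi/2 + asin y, hence at most either angle;
    this gives the weak bound. Strictness comes from monotonicity, comparing x with its midpoints to
    1 and -1. *)
Lemma disc_area_bound x : `|x| < 1 -> `|disc_area x| < pi / 2.
Proof.
move=> hx.
have bnd y : `|y| < 1 -> `|disc_area y| <= pi / 2.
  move=> hy; move: (hy); rewrite ltr_norml => /andP[y1 y2].
  have hyy : -1 <= y <= 1 by apply/andP; split; lra.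
  have hp1 := asin_lepi2 hyy; have hp2 := asin_geNpi2 hyy.
  have cE := cos_asin hyy; have sE : sin (asin y) = y by rewrite asinK// in_itv/=.
  have c0 : 0 <= Num.sqrt (1 - y ^+ 2) by exact: sqrtr_ge0.
  have u1 : Num.sqrt (1 - y ^+ 2) <= pi / 2 - asin y.
    have := @sin_le_id (pi / 2 - asin y); rewrite sinB sin_pihalf cos_pihalf cE.
    by rewrite mul1r mul0r subr0; apply; lra.
  have u2 : Num.sqrt (1 - y ^+ 2) <= pi / 2 + asin y.
    have := @sin_le_id (pi / 2 + asin y); rewrite sinD sin_pihalf cos_pihalf cE.
    by rewrite mul1r mul0r addr0; apply; lra.
  rewrite ler_norml /disc_area; apply/andP; split.
    have : - Num.sqrt (1 - y ^+ 2) <= y * Num.sqrt (1 - y ^+ 2).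
      by rewrite -mulN1r ler_wpM2r// ltW.
    by lra.
  have : y * Num.sqrt (1 - y ^+ 2) <= Num.sqrt (1 - y ^+ 2).
    by rewrite ler_piMl// ltW.
  by lra.
move: (hx); rewrite ltr_norml => /andP[x1 x2].
have h1 : `|(x + 1) / 2| < 1 by rewrite ltr_norml; apply/andP; split; lra.
have h2 : `|(x - 1) / 2| < 1 by rewrite ltr_norml; apply/andP; split; lra.
have := bnd _ h1; have := bnd _ h2; rewrite !ler_norml => /andP[a1 a2] /andP[b1 b2].
have c1 : disc_area x < disc_area ((x + 1) / 2) by apply: disc_area_lt => //; lra.
have c2 : disc_area ((x - 1) / 2) < disc_area x by apply: disc_area_lt => //; lra.
by rewrite ltr_norml; apply/andP; split; lra.
Qed.

(** With [disc_s] this maps the disc into the unit square, and dx dy = pi dq ds. *)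
Definition disc_q x : R := disc_area x / pi + 2^-1.
Definition disc_s x y : R := y / chord x + 2^-1.

Lemma norm_lt1_of_disc x y : x ^+ 2 + y ^+ 2 < 1 -> `|x| < 1.
Proof.
move=> h; rewrite -(@expr_lt1 _ 2)// real_normK ?num_real//.
by have := sqr_ge0 y; lra.
Qed.

Lemma disc_q_itv x : `|x| < 1 -> 0 < disc_q x < 1.
Proof.
move=> /disc_area_bound; have p0 : 0 < pi :> R := pi_gt0 R.
rewrite ltr_norml => /andP[h1 h2]; rewrite /disc_q; apply/andP; split.
  by rewrite -ltrBlDr sub0r ltr_pdivlMr//; lra.
by rewrite -ltrBrDr ltr_pdivrMr//; lra.
Qed.

Lemma disc_s_itv x y : x ^+ 2 + y ^+ 2 < 1 -> 0 < disc_s x y < 1.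
Proof.
move=> h; have hx := norm_lt1_of_disc h; have c0 := chord_gt0 hx.
have : `|y| < Num.sqrt (1 - x ^+ 2).
  by rewrite -sqrtr_sqr ltr_sqrt ?one_sub_sqr_gt0//; lra.
rewrite ltr_norml => /andP[h1 h2]; rewrite /disc_s; apply/andP; split.
  by rewrite -ltrBlDr sub0r ltr_pdivlMr// /chord; lra.
by rewrite -ltrBrDr ltr_pdivrMr// /chord; lra.
Qed.

Lemma disc_coord_inj x y x' y' : `|x| < 1 -> `|x'| < 1 ->
  disc_q x = disc_q x' -> disc_s x y = disc_s x' y' -> x = x' /\ y = y'.
Proof.
move=> hx hx' /addIr eq /addIr es.
have p0 : (pi : R) != 0 by rewrite gt_eqF ?pi_gt0.
have xx : x = x' by apply: disc_area_inj => //; exact: (divIf p0).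
split=> //; rewrite -xx in es; apply: divIf es.
by rewrite gt_eqF ?chord_gt0.
Qed.

(** The point sqrt Q e^(2 pi i t): Q is the squared radius and the area form is pi dQ dt, the same
    factor pi as for (q, s). *)
Definition polar_x Q t : R := Num.sqrt Q * cos (2 * pi * t).
Definition polar_y Q t : R := Num.sqrt Q * sin (2 * pi * t).

Lemma polar_sqr Q t : 0 <= Q -> polar_x Q t ^+ 2 + polar_y Q t ^+ 2 = Q.
Proof. by move=> Q0; rewrite !exprMn -mulrDr cos2Dsin2 mulr1 sqr_sqrtr. Qed.

Lemma cosD2pin t (n : nat) : cos (t + 2 * pi * n%:R) = cos t.
Proof.
elim: n t => [|n IH] t; first by rewrite mulr0 addr0.
have -> : t + 2 * pi * n.+1%:R = t + 2 * pi * n%:R + pi *+ 2.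
  by rewrite -mulr_natr -[n.+1]addn1 natrD; ring.
by rewrite cosD2pi.
Qed.

Lemma cosD2piz t z : z \is a Num.int -> cos (t + 2 * pi * z) = cos t.
Proof.
move=> /intrP[[n|n] ->]; first by rewrite cosD2pin.
by rewrite NegzE mulrNz mulrN -(cosD2pin (t - _) n.+1) subrK.
Qed.

Lemma cos_eq1 t : cos t = 1 -> exists2 z : R, z \is a Num.int & t = 2 * pi * z.
Proof.
move=> ct; have p0 : 0 < pi :> R := pi_gt0 R.
pose z := nint (t / (2 * pi)); have zi : z \is a Num.int := nint_int _.
exists z => //; pose t' := t - 2 * pi * z.
have ct' : cos t' = 1 by rewrite -ct -(cosD2piz t' zi) subrK.
have : `|t'| <= pi.
  have /andP[h1 h2] := nint_itv (t / (2 * pi)).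
  have t'E : t' = (t / (2 * pi) - z) * (2 * pi) by
    rewrite mulrBl divfK ?gt_eqF ?mulr_gt0// /t'; ring.
  rewrite t'E normrM [`|2 * pi|]gtr0_norm ?mulr_gt0// mulrCA -[leRHS]mul1r.
  rewrite mulrA; apply: ler_wpM2r; first exact: ltW.
  move: h1 h2; rewrite -/z; move: (t / (2 * pi)) => r h1 h2.
  have : `|r - z| <= 2^-1 by rewrite ler_norml; apply/andP; split; lra.
  by lra.
move=> ht; suff : `|t'| = 0 by move/normr0_eq0; rewrite /t'; lra.
by apply: cos_inj; rewrite ?in_itv/= ?normr_ge0 ?ht ?lexx ?ltW// cos_norm ct' cos0.
Qed.

Lemma polar_inj Q t Q' t' : 0 < Q -> 0 < Q' ->
  polar_x Q t = polar_x Q' t' -> polar_y Q t = polar_y Q' t' ->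
  Q = Q' /\ exists2 z : R, z \is a Num.int & t' = t + z.
Proof.
move=> Q0 Q'0 ex ey; have QQ : Q = Q'.
  by rewrite -(polar_sqr t (ltW Q0)) ex ey polar_sqr// ltW.
split=> //; move: ex ey; rewrite /polar_x /polar_y -QQ.
have s0 : Num.sqrt Q != 0 by rewrite gt_eqF ?sqrtr_gt0.
move=> /(mulfI s0) ec /(mulfI s0) es.
have [z zi E] : exists2 z : R, z \is a Num.int & 2 * pi * t' - 2 * pi * t = 2 * pi * z.
  by apply: cos_eq1; rewrite cosB ec es -!expr2 cos2Dsin2.
exists z => //; have p0 : (2 * pi : R) != 0 by rewrite gt_eqF ?mulr_gt0 ?pi_gt0.
by apply: (mulfI p0); rewrite -[LHS](subrK (2 * pi * t)) E; ring.
Qed.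

End AreaCoordinates.

(** * Derivatives and area form in polar coordinates *)

Section Wedge.
Context {R : realType} {V : normedModType R}.
Implicit Types (x v : V) (Q t f : V -> R).

Lemma is_derive_sqrt Q x v (dQ : R) : 0 < Q x -> is_derive x v Q dQ ->
  is_derive x v (fun y => Num.sqrt (Q y)) (dQ / (2 * Num.sqrt (Q x))).
Proof.
move=> Q0 dq; apply: is_derive_eq.
  exact: (is_derive_chain (is_derive1_sqrt Q0) dq).
by rewrite mulrC.
Qed.

Lemma is_derive_polar_x Q t x v (dQ dt : R) : 0 < Q x ->
  is_derive x v Q dQ -> is_derive x v t dt ->
  is_derive x v (fun y => polar_x (Q y) (t y))
    (dQ / (2 * Num.sqrt (Q x)) * cos (2 * pi * t x)
     - 2 * pi * dt * (Num.sqrt (Q x) * sin (2 * pi * t x))).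
Proof.
move=> Q0 dq dth; have d1 := is_derive_sqrt Q0 dq.
have d2 := @is_derive_chain _ _ cos (fun y => 2 * pi * t y) x v _ _
  (is_derive_cos _) (is_derive_scale (2 * pi) dth).
by apply: is_derive_eq (is_derive_mul d1 d2) _; rewrite /=; ring.
Qed.

Lemma is_derive_polar_y Q t x v (dQ dt : R) : 0 < Q x ->
  is_derive x v Q dQ -> is_derive x v t dt ->
  is_derive x v (fun y => polar_y (Q y) (t y))
    (dQ / (2 * Num.sqrt (Q x)) * sin (2 * pi * t x)
     + 2 * pi * dt * (Num.sqrt (Q x) * cos (2 * pi * t x))).
Proof.
move=> Q0 dq dth; have d1 := is_derive_sqrt Q0 dq.
have d2 := @is_derive_chain _ _ sin (fun y => 2 * pi * t y) x v _ _
  (is_derive_sin _) (is_derive_scale (2 * pi) dth).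
by apply: is_derive_eq (is_derive_mul d1 d2) _; rewrite /=; ring.
Qed.

Lemma polar_wedge (Q t dQ dt dQ' dt' : R) : 0 < Q ->
  (dQ / (2 * Num.sqrt Q) * cos (2 * pi * t)
     - 2 * pi * dt * (Num.sqrt Q * sin (2 * pi * t))) *
  (dQ' / (2 * Num.sqrt Q) * sin (2 * pi * t)
     + 2 * pi * dt' * (Num.sqrt Q * cos (2 * pi * t))) -
  (dQ / (2 * Num.sqrt Q) * sin (2 * pi * t)
     + 2 * pi * dt * (Num.sqrt Q * cos (2 * pi * t))) *
  (dQ' / (2 * Num.sqrt Q) * cos (2 * pi * t)
     - 2 * pi * dt' * (Num.sqrt Q * sin (2 * pi * t)))
  = pi * (dQ * dt' - dt * dQ').
Proof.
move=> Q0; have s0 : Num.sqrt Q != 0 by rewrite gt_eqF ?sqrtr_gt0.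
transitivity (pi * (dQ * dt' - dt * dQ')
  * (cos (2 * pi * t) ^+ 2 + sin (2 * pi * t) ^+ 2)); last by rewrite cos2Dsin2 mulr1.
by field.
Qed.

End Wedge.

(** * The embedding in coordinates: bounds and smoothness *)

Section Embedding.
Context {R : realType}.
Implicit Types (S r : R) (x : nat -> R).

Definition gap r : R := r - Num.sqrt 3.
(** Growing with the gap, this keeps the width below 1/100 however large the gap is, while slope
    times width is exactly gap / 100. *)
Definition slope r : R := 1 + gap r.
Definition width r : R := gap r / 100 / slope r.
(** rho can fall to base - speed - 21 m w; the 23 leaves it at least 2 m w > 0. *)
Definition base r : R := speed (width r) + 23 * (slope r * width r).
(** With [strip_v] this sends the disc of radius S into the strip |u| < gap / 100, |v| < S^2 / (pi
    gap / 100), and dx_2 dx_3 = pi du dv in the numbering of the code. *)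
Definition strip_u S r (t : R) : R := t * (gap r / 100) / S.
Definition strip_v S r (t : R) : R := t * S / (pi * (gap r / 100)).
Definition squeeze S r : R := Num.sqrt (gap r / 100) / S.

Definition embQ S r x : R :=
  midQ (width r) (slope r) (disc_q (x 0%N)) (disc_s (x 0%N) (x 1%N))
    (strip_u S r (x 2%N)) (strip_v S r (x 3%N)).
Definition embT S r x : R :=
  mid_theta (width r) (slope r) S (strip_u S r (x 2%N)) (strip_v S r (x 3%N)) (x 5%N).
Definition embRho S r x : R :=
  mid_rho (width r) (slope r) (base r) S (disc_s (x 0%N) (x 1%N))
    (strip_u S r (x 2%N)) (strip_v S r (x 3%N)) (x 5%N).
Definition embG S r x : R :=
  mid_gamma (width r) S (strip_v S r (x 3%N)) (x 4%N).

Definition emb S r x (i : nat) : R :=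
  match i with
  | 0%N => polar_x (embQ S r x) (disc_s (x 0%N) (x 1%N))
  | 1%N => polar_y (embQ S r x) (disc_s (x 0%N) (x 1%N))
  | 2%N => polar_x (embRho S r x) (embT S r x)
  | 3%N => polar_y (embRho S r x) (embT S r x)
  | 4%N => squeeze S r * embG S r x
  | 5%N => x 5%N / squeeze S r
  | _ => x i
  end.

Definition admissible S r x :=
  [/\ 0 < S, 0 < gap r, x 0%N ^+ 2 + x 1%N ^+ 2 < 1 & `|x 2%N| < S].

Lemma slope_ge1 r : 0 < gap r -> 1 <= slope r.
Proof. by rewrite /slope => h; rewrite lerDl ltW. Qed.

Lemma slope_gt0 r : 0 < gap r -> 0 < slope r.
Proof. by move=> /slope_ge1; exact: lt_le_trans. Qed.

Lemma slope_width r : 0 < gap r -> slope r * width r = gap r / 100.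
Proof. by move=> /slope_gt0 h; rewrite /width mulrC divfK// gt_eqF. Qed.

Lemma width_itv r : 0 < gap r -> 0 < width r <= 100^-1.
Proof.
move=> h; have s0 := slope_gt0 h; rewrite /width divr_gt0 ?divr_gt0//=.
by rewrite ler_pdivrMr// mulrC ler_pM2l ?invr_gt0// /slope; lra.
Qed.

Section Admissible.
Variables (S r : R) (x : nat -> R).
Hypothesis adm : admissible S r x.

Lemma adm_norm0 : `|x 0%N| < 1.
Proof. by case: adm => _ _ h _; exact: norm_lt1_of_disc h. Qed.

Lemma adm_q : 0 < disc_q (x 0%N) < 1.
Proof. exact: disc_q_itv adm_norm0. Qed.

Lemma adm_s : 0 < disc_s (x 0%N) (x 1%N) < 1.
Proof. by case: adm => _ _ h _; exact: disc_s_itv. Qed.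

Lemma adm_u : `|strip_u S r (x 2%N)| < slope r * width r.
Proof.
case: adm => S0 g0 _ h; rewrite slope_width// /strip_u norm_div_pos// normrM.
have e0 : 0 < gap r / 100 by rewrite divr_gt0.
by rewrite (gtr0_norm e0) ltr_pdivrMr// mulrC ltr_pM2l.
Qed.

(** The sum is below 1 + speed + 44 m w <= 3 + 100 w + 44 m w, and w <= m w = gap / 100. *)
Lemma adm_bounds : [/\ 0 < embQ S r x, 0 < embRho S r x &
  embQ S r x + embRho S r x < 3 + 3 * gap r].
Proof.
case: (adm) => S0 g0 _ _.
have ww := width_itv g0; have m1 := slope_ge1 g0.
have [h1 h2 h3] := mid_bounds (base r) S ww m1 (strip_v S r (x 3%N)) (x 5%N)
  adm_q adm_s adm_u.
have k2 := speed_le ww; have mw := slope_width g0.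
have wmw : width r <= slope r * width r.
  by rewrite ler_peMl//; case/andP: ww => /ltW.
move: h2 h3; rewrite -/(embRho S r x) -/(embQ S r x) /base mw => h2 h3.
by rewrite mw in wmw; split=> //; lra.
Qed.

End Admissible.

Section EmbSmooth.
Context {V : normedModType R}.
Variables (A : set V) (Sf rf : V -> R) (xf : nat -> V -> R).
Hypothesis oA : open A.
Hypotheses (Ss : smooth A Sf) (rs : smooth A rf) (xs : forall k, smooth A (xf k)).
Hypothesis hA : forall z, A z -> admissible (Sf z) (rf z) (fun k => xf k z).

Let S0 z : A z -> 0 < Sf z. Proof. by move=> /hA[]. Qed.
Let g0 z : A z -> 0 < gap (rf z). Proof. by move=> /hA[]. Qed.

Let gs : smooth A (fun z => gap (rf z)).
Proof. by apply: smoothB => //; exact: smooth_cst. Qed.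

Let es : smooth A (fun z => gap (rf z) / 100).
Proof. by apply: smoothM => //; exact: smooth_cst. Qed.

Let ms : smooth A (fun z => slope (rf z)).
Proof. by apply: smoothD => //; exact: smooth_cst. Qed.

Let mVs : smooth A (fun z => (slope (rf z))^-1).
Proof. by apply: smoothV => // z /g0; exact: slope_gt0. Qed.

Let wsm : smooth A (fun z => width (rf z)).
Proof. exact: smoothM. Qed.

Let w8 z : A z -> 0 < width (rf z) <= 8^-1.
Proof. by move=> /g0 /width_itv; exact: small_width. Qed.

Let smoothZ c f : smooth A f -> smooth A (fun z : V => c * f z).
Proof. by move=> fs; apply: smoothM => //; exact: smooth_cst. Qed.

Let kVs : smooth A (fun z => 2^-1 - 15 * width (rf z)).
Proof. by apply: smoothB; [exact: smooth_cst|exact: smoothZ]. Qed.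

Let ks : smooth A (fun z => speed (width (rf z))).
Proof.
apply: smoothV => // z /g0 /width_itv /andP[w0 w1].
by move: (width _) w0 w1 => w *; lra.
Qed.

Let kinv : smooth A (fun z => (speed (width (rf z)))^-1).
Proof. by apply: smoothV => // z /g0 /width_itv; exact: speed_gt0. Qed.

Let mws : smooth A (fun z => slope (rf z) * width (rf z)).
Proof. exact: smoothM. Qed.

Let bs : smooth A (fun z => base (rf z)).
Proof. by apply: smoothD => //; exact: smoothZ. Qed.

Let SVs : smooth A (fun z => (Sf z)^-1).
Proof. exact: smoothV. Qed.

Let us : smooth A (fun z => strip_u (Sf z) (rf z) (xf 2%N z)).
Proof. by apply: smoothM => //; apply: smoothM. Qed.

Let vs : smooth A (fun z => strip_v (Sf z) (rf z) (xf 3%N z)).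
Proof.
apply: smoothM; first exact: smoothM.
apply: smoothV; first exact: smoothZ.
by move=> z /g0 h; rewrite mulr_gt0 ?pi_gt0// divr_gt0.
Qed.

Let norm0 z : A z -> `|xf 0%N z| < 1.
Proof. by move=> /hA; exact: adm_norm0. Qed.

Let qs : smooth A (fun z => disc_q (xf 0%N z)).
Proof.
apply: smoothD; last exact: smooth_cst.
apply: smoothM; last exact: smooth_cst.
exact: (smooth_comp open_norm_lt1 smooth_disc_area (xs 0%N) norm0).
Qed.

Let ss : smooth A (fun z => disc_s (xf 0%N z) (xf 1%N z)).
Proof.
apply: smoothD; last exact: smooth_cst.
apply: smoothM => //; apply: smoothV; last by move=> z /norm0; exact: chord_gt0.
exact: (smooth_comp open_norm_lt1 smooth_chord (xs 0%N) norm0).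
Qed.

Let smooth_stw f : smooth A f -> smooth A (fun z => st (width (rf z)) (f z)).
Proof. by move=> fs; apply: smooth_st. Qed.

Let waves : smooth A (fun z => wave (width (rf z)) (phase (width (rf z))
  (slope (rf z)) (disc_s (xf 0%N z) (xf 1%N z))
  (strip_u (Sf z) (rf z) (xf 2%N z)) (strip_v (Sf z) (rf z) (xf 3%N z)))).
Proof.
have phs : smooth A (fun z => phase (width (rf z))
  (slope (rf z)) (disc_s (xf 0%N z) (xf 1%N z))
  (strip_u (Sf z) (rf z) (xf 2%N z)) (strip_v (Sf z) (rf z) (xf 3%N z))).
  apply: smoothB; last exact: smoothM.
  by apply: smoothD => //; apply: smoothM.
apply: smoothB; apply: smooth_stw; apply: smoothB => //; try exact: smoothZ.
by apply: smoothB => //; exact: smooth_cst.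
Qed.

Let Qs : smooth A (fun z => embQ (Sf z) (rf z) (fun k => xf k z)).
Proof. exact: smoothD. Qed.

Let slides : smooth A (fun z => slide (width (rf z)) (Sf z)
  (strip_u (Sf z) (rf z) (xf 2%N z)) (strip_v (Sf z) (rf z) (xf 3%N z)) (xf 5%N z)
  / slope (rf z)).
Proof.
apply: smoothM => //; apply: smoothB => //; apply: smoothM; last exact: smooth_dst.
apply: smoothM => //; apply: smoothM; last exact: smooth_cst.
exact: smoothZ.
Qed.

Let Ts : smooth A (fun z => embT (Sf z) (rf z) (fun k => xf k z)).
Proof. exact: smoothD. Qed.

Let zts : smooth A (fun z => zt (width (rf z)) (strip_v (Sf z) (rf z) (xf 3%N z))).
Proof. exact: smooth_zt. Qed.

Let profiles f : smooth A f ->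
  smooth A (fun z => profile (width (rf z)) (slope (rf z)) (base (rf z)) (f z)).
Proof.
move=> fs; have hc := @smooth_cst R V A; rewrite /profile /up /down.
have w8s : smooth A (fun z => 8 * width (rf z)) by exact: smoothZ.
have w5s : smooth A (fun z => 5 * width (rf z)) by exact: smoothZ.
apply: smoothB.
  apply: smoothD; last first.
    apply: smoothM; first exact: smoothZ.
    by apply: smoothB; apply: smooth_stw; apply: smoothB.
  apply: smoothD => //; apply: smoothM => //; apply: smooth_zt => //.
  by move=> z /g0 /width_itv; exact: small_width8.
apply: smoothM; first by apply: smoothD => //; exact: smoothZ.
by apply: smoothB; apply: smooth_stw; apply: smoothD.
Qed.

Let rhos : smooth A (fun z => embRho (Sf z) (rf z) (fun k => xf k z)).
Proof.
apply: smoothB; last exact: smoothM.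
apply: smoothB; last exact: smoothM.
by apply: profiles; apply: smoothD.
Qed.

Let polar_xs Q t : smooth A Q -> smooth A t -> (forall z, A z -> 0 < Q z) ->
  smooth A (fun z => polar_x (Q z) (t z)) /\ smooth A (fun z => polar_y (Q z) (t z)).
Proof.
move=> Qs' ts Q0; have h : smooth A (fun z => 2 * pi * t z) by exact: smoothZ.
by split; (apply: smoothM; first exact: smooth_sqrt);
  [exact: smooth_compT smooth_cos h|exact: smooth_compT smooth_sin h].
Qed.

Let sqs : smooth A (fun z => squeeze (Sf z) (rf z)).
Proof.
apply: smoothM => //; apply: smooth_sqrt => // z /g0 h; exact: divr_gt0.
Qed.

Lemma squeeze_gt0 S r : 0 < S -> 0 < gap r -> 0 < squeeze S r.
Proof. by move=> h1 h2; rewrite divr_gt0// sqrtr_gt0 divr_gt0. Qed.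

(** S, r and the coordinates are arbitrary smooth functions on an open set, so that this one
    statement serves both a fixed embedding (constant S, r) and the whole family. *)
Lemma smooth_emb i : smooth A (fun z => emb (Sf z) (rf z) (fun k => xf k z) i).
Proof.
have Q0 z : A z -> 0 < embQ (Sf z) (rf z) (fun k => xf k z).
  by move=> /hA /adm_bounds[].
have rho0 z : A z -> 0 < embRho (Sf z) (rf z) (fun k => xf k z).
  by move=> /hA /adm_bounds[].
have [p1 p2] := polar_xs Qs ss Q0; have [p3 p4] := polar_xs rhos Ts rho0.
case: i => [|[|[|[|[|[|i]]]]]] //.
- apply: smoothM => //; apply: smoothB => //.
  by apply: smoothM; [exact: smoothZ|exact: smooth_stw].
- apply: smoothM => //; apply: smoothV => // z Az.
  by apply: squeeze_gt0; [exact: S0|exact: g0].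
- exact: xs.
Qed.

End EmbSmooth.
End Embedding.

(** * The differential of the embedding preserves the form *)

Section EmbGeometry.
Context {R : realType}.
Implicit Types (S r : R) (x a : nat -> R).

(** If W = 0 and Z = 1, then drho = P dth - m dv, so drho wedge dth = dal wedge dv, and the terms in
    H from [dal] and [dga] cancel. If H = H1 = 0 and P = m, then drho = du - k W (dth - ds / k), and
    the terms in W cancel because ds - k dth is a multiple of dth - ds / k. *)
Lemma mid_symplectic (k m S W H H1 P Z Y : R)
    (dq ds du dv dX dY dq' ds' du' dv' dX' dY' : R) :
  k != 0 -> m != 0 -> W = 0 /\ Z = 1 \/ [/\ H = 0, H1 = 0 & P = m] ->
  let dQ := dq + W * (dv + du / m - ds / k) in
  let dal := du - 2 * S / pi * (Y * (H1 * dv) + H * dY) in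
  let dth := dv + dal / m in
  let drho := P * (dal / m + Z * dv) - m * (Z * dv)
              - k * (W * (dv + du / m - ds / k)) in
  let dga := dX - 2 * S * (H * dv) in
  let dQ' := dq' + W * (dv' + du' / m - ds' / k) in
  let dal' := du' - 2 * S / pi * (Y * (H1 * dv') + H * dY') in
  let dth' := dv' + dal' / m in
  let drho' := P * (dal' / m + Z * dv') - m * (Z * dv')
              - k * (W * (dv' + du' / m - ds' / k)) in
  let dga' := dX' - 2 * S * (H * dv') in
  pi * (dQ * ds' - ds * dQ') + pi * (drho * dth' - dth * drho')
    + (dga * dY' - dY * dga')
  = pi * (dq * ds' - ds * dq') + pi * (du * dv' - dv * du')
    + (dX * dY' - dY * dX').
Proof.
move=> k0 m0 cases /=; have p0 : (pi : R) != 0 by rewrite gt_eqF ?pi_gt0.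
move: (pi : R) p0 => p p0.
by case: cases => [[-> ->]|[-> -> ->]]; field; rewrite ?k0 ?m0 ?p0.
Qed.

(* Derivative of the map along a tangent vector with coordinates [a], in terms
   of the derivatives of the profile functions at the point. *)
Definition emb_tangent S r x (L W H H1 P Z : R) a (i : nat) : R :=
  let m := slope r in let k := speed (width r) in let g := gap r / 100 in
  let dq := chord (x 0%N) * a 0%N / pi in
  let ds := a 1%N / chord (x 0%N) + L * a 0%N in
  let du := a 2%N * (g / S) in
  let dv := a 3%N * (S / (pi * g)) in
  let dQ := dq + W * (dv + du / m - ds / k) in
  let dal := du - 2 * S / pi * (x 5%N * (H1 * dv) + H * a 5%N) in
  let dth := dv + dal / m in
  let drho := P * (dal / m + Z * dv) - m * (Z * dv)
              - k * (W * (dv + du / m - ds / k)) in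
  let Q := embQ S r x in let s := disc_s (x 0%N) (x 1%N) in
  let rho := embRho S r x in let th := embT S r x in
  match i with
  | 0%N => dQ / (2 * Num.sqrt Q) * cos (2 * pi * s)
           - 2 * pi * ds * (Num.sqrt Q * sin (2 * pi * s))
  | 1%N => dQ / (2 * Num.sqrt Q) * sin (2 * pi * s)
           + 2 * pi * ds * (Num.sqrt Q * cos (2 * pi * s))
  | 2%N => drho / (2 * Num.sqrt rho) * cos (2 * pi * th)
           - 2 * pi * dth * (Num.sqrt rho * sin (2 * pi * th))
  | 3%N => drho / (2 * Num.sqrt rho) * sin (2 * pi * th)
           + 2 * pi * dth * (Num.sqrt rho * cos (2 * pi * th))
  | 4%N => squeeze S r * (a 4%N - 2 * S * (H * dv))
  | 5%N => a 5%N / squeeze S r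
  | _ => a i
  end.

Lemma emb_tangent_symplectic S r x L W H H1 P Z a a' : admissible S r x ->
  W = 0 /\ Z = 1 \/ [/\ H = 0, H1 = 0 & P = slope r] ->
  let D := emb_tangent S r x L W H H1 P Z a in
  let D' := emb_tangent S r x L W H H1 P Z a' in
  (D 0%N * D' 1%N - D 1%N * D' 0%N) + (D 2%N * D' 3%N - D 3%N * D' 2%N)
  + (D 4%N * D' 5%N - D 5%N * D' 4%N) =
  (a 0%N * a' 1%N - a 1%N * a' 0%N) + (a 2%N * a' 3%N - a 3%N * a' 2%N)
  + (a 4%N * a' 5%N - a 5%N * a' 4%N).
Proof.
move=> adm cases /=; case: (adm) => S0 g0 _ _.
have [Q0 rho0 _] := adm_bounds adm.
rewrite !polar_wedge//.
have sq0 : squeeze S r != 0 by rewrite gt_eqF ?squeeze_gt0.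
have sqE (b c b' c' : R) : squeeze S r * b * (c' / squeeze S r)
    - c / squeeze S r * (squeeze S r * b') = b * c' - c * b' by field.
rewrite sqE.
have k0 : speed (width r) != 0 by rewrite gt_eqF// speed_gt0// width_itv.
have m0 : slope r != 0 by rewrite gt_eqF ?slope_gt0.
have /= -> := @mid_symplectic (speed (width r)) (slope r) S W H H1 P Z (x 5%N)
  (chord (x 0%N) * a 0%N / pi) (a 1%N / chord (x 0%N) + L * a 0%N)
  (a 2%N * (gap r / 100 / S)) (a 3%N * (S / (pi * (gap r / 100)))) (a 4%N) (a 5%N)
  (chord (x 0%N) * a' 0%N / pi) (a' 1%N / chord (x 0%N) + L * a' 0%N)
  (a' 2%N * (gap r / 100 / S)) (a' 3%N * (S / (pi * (gap r / 100)))) (a' 4%N) (a' 5%N)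
  k0 m0 cases.
have p0 : (pi : R) != 0 by rewrite gt_eqF ?pi_gt0.
have c0 : chord (x 0%N) != 0 by rewrite gt_eqF// chord_gt0// (adm_norm0 adm).
have g1 : gap r != 0 by rewrite gt_eqF.
have s1 : S != 0 by rewrite gt_eqF.
move: (chord _) c0 => c c0; move: (gap r) g1 => g g1.
move: (pi : R) p0 => p p0.
by field; rewrite p0 c0 g1 s1.
Qed.

(** The coefficients are chosen before the direction [d], so that the same ones serve both arguments
    of omega. [L] is the derivative of y / chord(x) in x. *)
Lemma is_derive_emb (V : normedModType R) S r (xf : nat -> V -> R) z :
  admissible S r (fun k => xf k z) ->
  exists L W H H1 P Z : R,
  (W = 0 /\ Z = 1 \/ [/\ H = 0, H1 = 0 & P = slope r]) /\
  forall d a, (forall k, is_derive z d (xf k) (a k)) ->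
  forall i, is_derive z d (fun y => emb S r (fun k => xf k y) i)
    (emb_tangent S r (fun k => xf k z) L W H H1 P Z a i).
Proof.
move=> adm; case: (adm) => S0 g0 _ _.
have x0n := adm_norm0 adm; have ww := width_itv g0; have m1 := slope_ge1 g0.
have [Q0 rho0 _] := adm_bounds adm.
have [W [H [H1 [P [Z [[dW dH dH1 dP dZ] [HE cases]]]]]]] :=
  mid_derivatives (base r) S ww m1 (strip_v S r (xf 3%N z)) (xf 5%N z)
    (adm_s adm) (adm_u adm).
have cVs : smooth [set t : R | `|t| < 1] (fun t => (chord t)^-1).
  by apply: smoothV; [exact: smooth_chord|move=> t; exact: chord_gt0].
pose L0 : R := 'D_1 (fun t => (chord t)^-1) (xf 0%N z).
have dL : is_derive (xf 0%N z) 1 (fun t => (chord t)^-1) L0.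
  exact: (smooth_is_derive (x := xf 0%N z) 1 cVs x0n).
exists (xf 1%N z * L0), W, H, H1, P, Z; split=> // d a da.
pose m := slope r; pose k := speed (width r).
pose qf y := disc_q (xf 0%N y); pose sf y := disc_s (xf 0%N y) (xf 1%N y).
pose uf y := strip_u S r (xf 2%N y); pose vf y := strip_v S r (xf 3%N y).
pose dq := chord (xf 0%N z) * a 0%N / pi.
pose ds := a 1%N / chord (xf 0%N z) + xf 1%N z * L0 * a 0%N.
pose du := a 2%N * (gap r / 100 / S).
pose dv := a 3%N * (S / (pi * (gap r / 100))).
have scaleR f (c df : R) : is_derive z d f df ->
  is_derive z d (fun y => f y * c) (df * c).
  move=> hf; apply: (@is_derive_ext _ _ (fun y => c * f y)).
    by move=> y; rewrite mulrC.
  by rewrite mulrC; exact: is_derive_scale.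
have Dq : is_derive z d qf dq.
  have h := scaleR _ pi^-1 _
    (is_derive_chain (g := xf 0%N) (is_derive_disc_area x0n) (da 0%N)).
  by apply: is_derive_eq (is_deriveD h (is_derive_cst (2^-1 : R) z d)) _; rewrite addr0.
have Ds : is_derive z d sf ds.
  have h := is_derive_mul (da 1%N) (is_derive_chain (g := xf 0%N) dL (da 0%N)).
  apply: is_derive_eq (is_deriveD h (is_derive_cst (2^-1 : R) z d)) _.
  by rewrite /ds /=; ring.
have Du : is_derive z d uf du.
  apply: is_derive_ext (scaleR _ (gap r / 100 / S) _ (da 2%N)).
  by move=> y; rewrite /uf /strip_u mulrA.
have Dv : is_derive z d vf dv.
  apply: is_derive_ext (scaleR _ (S / (pi * (gap r / 100))) _ (da 3%N)).
  by move=> y; rewrite /vf /strip_v mulrA.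
have Dy : is_derive z d (fun y => phase (width r) m (sf y) (uf y) (vf y))
    (dv + du / m - ds / k).
  exact: (is_deriveB (is_deriveD Dv (scaleR _ m^-1 _ Du)) (scaleR _ k^-1 _ Ds)).
have Dw := is_derive_chain (g := fun y => phase (width r) m (sf y) (uf y) (vf y)) dW Dy.
have DQ : is_derive z d (fun y => embQ S r (fun k => xf k y))
    (dq + W * (dv + du / m - ds / k)) by exact: (is_deriveD Dq Dw).
have Dh1 := is_derive_chain (g := vf) dH1 Dv.
pose dal := du - 2 * S / pi * (xf 5%N z * (H1 * dv) + H * a 5%N).
have Dal : is_derive z d (fun y => slide (width r) S (uf y) (vf y) (xf 5%N y)) dal.
  have h := is_derive_scale (2 * S / pi) (is_derive_mul (da 5%N) Dh1).
  (* The coefficient of dY is the value of [dst], here identified with the slope [H] of the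
     staircase; this match is what makes the shift of X and the slide of u cancel. *)
  rewrite /dal {1}HE; apply: is_derive_ext (is_deriveB Du h).
  by move=> y; rewrite /slide -[_ * xf 5%N y * _]mulrA.
have DT : is_derive z d (fun y => embT S r (fun k => xf k y)) (dv + dal / m).
  exact: (is_deriveD Dv (scaleR _ m^-1 _ Dal)).
have Dz := is_derive_chain (g := vf) dZ Dv.
pose drho := P * (dal / m + Z * dv) - m * (Z * dv) - k * (W * (dv + du / m - ds / k)).
have Darg : is_derive z d (fun y => slide (width r) S (uf y) (vf y) (xf 5%N y) / m
    + zt (width r) (vf y)) (dal / m + Z * dv).
  exact: (is_deriveD (scaleR _ m^-1 _ Dal) Dz).
have Dp := is_derive_chain (g := fun y => slide (width r) S (uf y) (vf y) (xf 5%N y) / m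
    + zt (width r) (vf y)) dP Darg.
have Drho : is_derive z d (fun y => embRho S r (fun k => xf k y)) drho.
  exact: (is_deriveB (is_deriveB Dp (is_derive_scale m Dz)) (is_derive_scale k Dw)).
case=> [|[|[|[|[|[|i]]]]]].
- exact: is_derive_polar_x.
- exact: is_derive_polar_y.
- exact: is_derive_polar_x.
- exact: is_derive_polar_y.
- exact: (is_derive_scale (squeeze S r) (is_deriveB (da 4%N)
    (is_derive_scale (2 * S) (is_derive_chain (g := vf) dH Dv)))).
- exact: (scaleR _ (squeeze S r)^-1 _ (da 5%N)).
- exact: da.
Qed.

End EmbGeometry.

(** * Injectivity and size of the image *)

Section EmbProperties.
Context {R : realType}.
Implicit Types (S r : R) (x : nat -> R).

(** The first polar angle determines s, since s lies in (0, 1). The second determines theta only up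
    to an integer j, which [mid_injective] allows for. *)
Lemma emb_inj S r x x' : admissible S r x -> admissible S r x' ->
  `|x 4%N - x' 4%N| < 2 * S -> (forall i, emb S r x i = emb S r x' i) -> x =1 x'.
Proof.
move=> adm adm' h4 E; case: (adm) => S0 g0 _ _.
have [Q0 rho0 _] := adm_bounds adm; have [Q0' rho0' _] := adm_bounds adm'.
have [QE [z zi sE]] := polar_inj Q0 Q0' (E 0%N) (E 1%N).
have [rhoE [j ji TE]] := polar_inj rho0 rho0' (E 2%N) (E 3%N).
have {}sE : disc_s (x' 0%N) (x' 1%N) = disc_s (x 0%N) (x 1%N).
  rewrite sE (int_lt1_eq0 zi) ?addr0//.
  have := adm_s adm; have := adm_s adm'; rewrite sE.
  move: (disc_s _ _) => s /andP[a1 a2] /andP[b1 b2].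
  by rewrite ltr_norml; apply/andP; split; clear -a1 a2 b1 b2; lra.
have sq0 : squeeze S r != 0 by rewrite gt_eqF ?squeeze_gt0.
have E5 : x 5%N = x' 5%N by have := E 5%N => /= /(divIf sq0).
have GE : embG S r x = embG S r x' by have := E 4%N => /= /(mulfI sq0).
have ww := width_itv g0; have m1 := slope_ge1 g0.
move: QE rhoE TE; rewrite /embQ /embRho /embT sE -E5 => QE rhoE TE.
have [eq eu ev E4] := mid_injective ww m1 S0 (adm_q adm) (adm_q adm') (adm_s adm)
  (adm_u adm) (adm_u adm') h4 ji QE rhoE TE GE.
have [E0 E1] := disc_coord_inj (adm_norm0 adm) (adm_norm0 adm') eq (esym sE).
have gn0 : gap r / 100 != 0 by rewrite gt_eqF ?divr_gt0.
have Sn0 : S != 0 by rewrite gt_eqF.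
have E2 : x 2%N = x' 2%N by move: eu => /(divIf Sn0) /(mulIf gn0).
have E3 : x 3%N = x' 3%N.
  have pn0 : pi * (gap r / 100) != 0 by rewrite mulf_neq0// gt_eqF ?pi_gt0.
  by move: ev => /(divIf pn0) /(mulIf Sn0).
by case=> [|[|[|[|[|[|i]]]]]] //; exact: (E i.+4.+2).
Qed.

(** Used for r^2 >= 3 + 2 sqrt 3 gap >= 3 + 3 gap, to meet the bound of [adm_bounds]. *)
Lemma sqrt3_ge : 3 / 2 <= Num.sqrt 3 :> R.
Proof.
have : (3 / 2) ^+ 2 <= Num.sqrt 3 ^+ 2 :> R by rewrite sqr_sqrtr//; lra.
by rewrite ler_sqr// nnegrE ?sqrtr_ge0//; lra.
Qed.

Lemma emb_first_ball S r x : admissible S r x ->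
  emb S r x 0%N ^+ 2 + emb S r x 1%N ^+ 2 +
  (emb S r x 2%N ^+ 2 + emb S r x 3%N ^+ 2) < r ^+ 2.
Proof.
move=> adm; case: (adm) => S0 g0 _ _; have [Q0 rho0 h] := adm_bounds adm.
rewrite /= !polar_sqr ?(ltW Q0) ?(ltW rho0)//; apply: lt_le_trans h _.
have rE : r = Num.sqrt 3 + gap r by rewrite /gap addrC subrK.
have s3 := sqrt3_ge; have s33 : Num.sqrt 3 ^+ 2 = 3 :> R by rewrite sqr_sqrtr.
rewrite [in leRHS]rE; move: (gap r) g0 => g g0.
move: (Num.sqrt 3) s3 s33 => t s3 s33.
have : 0 <= (t - 3 / 2) * g by rewrite mulr_ge0//; lra.
have := sqr_ge0 g; rewrite mulrBl sqrrD s33 => h1 h2.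
by rewrite -mulr_natr; lra.
Qed.

(** With K = S^2 / (gap / 100) there are at most K + 2 shifts by 2 S, and S + 2 S (K + 2) <= 3 S K
    because gap < S^2 gives K >= 100. *)
Lemma emb_gamma_bound S r x : admissible S r x -> gap r < S ^+ 2 ->
  `|x 3%N| < S -> `|x 4%N| < S ->
  `|embG S r x| <= 3 * S ^+ 3 / (gap r / 100).
Proof.
move=> adm gS h3 h4; case: (adm) => S0 g0 _ _.
set g := gap r / 100; have gg : 0 < g by rewrite divr_gt0.
have hg : 100 * g < S ^+ 2 by rewrite /g mulrC divfK.
have := st_bound (width r) (strip_v S r (x 3%N)); rewrite -/g.
have hv : `|strip_v S r (x 3%N)| <= S ^+ 2 / g.
  rewrite /strip_v -/g normrM normrM (gtr0_norm S0).
  have pg : 0 < pi * g by rewrite mulr_gt0 ?pi_gt0.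
  rewrite [X in _ * X]gtr0_norm ?invr_gt0//.
  rewrite ler_pdivrMr//.
  have p1 : 1 <= pi :> R by rewrite (le_trans _ (pi_ge2 R))//; lra.
  have -> : S ^+ 2 / g * (pi * g) = S * S * pi by field; rewrite gt_eqF.
  apply: (@le_trans _ _ (S * S)); first by rewrite ler_wpM2r ?(ltW S0)// ltW.
  by rewrite ler_peMr// mulr_ge0 ?ltW.
move=> hst.
have [K KE] : exists K, K = S ^+ 2 / g by exists (S ^+ 2 / g).
have K100 : 100 <= K by rewrite KE ler_pdivlMr// ltW.
have -> : 3 * S ^+ 3 / g = 3 * S * K by rewrite KE; ring.
rewrite /embG /mid_gamma (le_trans (ler_normB _ _))// normrM.
rewrite [`|2 * S|]gtr0_norm ?mulr_gt0//.
have : 2 * S * `|st (width r) (strip_v S r (x 3%N))| <= 2 * S * (K + 2).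
  by rewrite ler_pM2l ?mulr_gt0//; rewrite KE; lra.
have : S * 100 <= S * K by rewrite ler_pM2l.
by move: h4; rewrite mulrDr; lra.
Qed.

Lemma emb_second_ball S r x (rest : R) : admissible S r x -> gap r < S ^+ 2 ->
  `|x 3%N| < S -> `|x 4%N| < S -> `|x 5%N| < S -> rest <= S ^+ 2 ->
  emb S r x 4%N ^+ 2 + emb S r x 5%N ^+ 2 + rest
    < (34 * S ^+ 2 / Num.sqrt (gap r)) ^+ 2.
Proof.
move=> adm gS h3 h4 h5 hr; case: (adm) => S0 g0 _ _.
have hG := emb_gamma_bound adm gS h3 h4.
set g := gap r / 100 in hG; have gg : 0 < g by rewrite divr_gt0.
have hg : 100 * g < S ^+ 2 by rewrite /g mulrC divfK.
have sq2 : squeeze S r ^+ 2 = g / S ^+ 2.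
  by rewrite /squeeze expr_div_n sqr_sqrtr ?ltW.
have gE : gap r = 100 * g by rewrite /g mulrC divfK.
have S20 : 0 < S ^+ 2 by rewrite exprn_gt0.
pose K := S ^+ 4 / g.
have gn : g != 0 by rewrite gt_eqF.
have Sn : S != 0 by rewrite gt_eqF.
(* The two coordinates contribute at most 9 K and K, the remaining ones at most S^2 <= K; 34 is
   chosen so that 34^2 / 100 > 11. *)
have -> : (34 * S ^+ 2 / Num.sqrt (gap r)) ^+ 2 = 1156 / 100 * K.
  by rewrite !expr_div_n sqr_sqrtr ?ltW// gE /K; field.
have e4 : emb S r x 4%N ^+ 2 <= 9 * K.
  have -> : emb S r x 4%N ^+ 2 = g / S ^+ 2 * `|embG S r x| ^+ 2.
    by rewrite /= exprMn sq2 real_normK ?num_real.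
  have -> : 9 * K = g / S ^+ 2 * (3 * S ^+ 3 / g) ^+ 2.
    by rewrite /K; field; rewrite gn Sn.
  rewrite ler_pM2l ?divr_gt0// ler_sqr ?nnegrE//.
  by rewrite divr_ge0 ?mulr_ge0 ?exprn_ge0 ?ltW.
have e5 : emb S r x 5%N ^+ 2 <= K.
  have -> : emb S r x 5%N ^+ 2 = `|x 5%N| ^+ 2 * (S ^+ 2 / g).
    by rewrite /= expr_div_n sq2 real_normK ?num_real// invf_div.
  have -> : K = S ^+ 2 * (S ^+ 2 / g) by rewrite /K; field.
  by rewrite ler_pM2r ?divr_gt0// ler_sqr ?nnegrE ?(ltW S0)// ltW.
have e6 : S ^+ 2 <= K.
  have -> : K = S ^+ 2 * (S ^+ 2 / g) by rewrite /K; field.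
  by rewrite ler_peMr ?(ltW S20)// ler_pdivlMr//; lra.
have K0 : 0 < K by rewrite (lt_le_trans S20).
by lra.
Qed.

End EmbProperties.

(** * Transfer to row vectors and to the family *)

Section EmbeddingMap.
Context {R : realType}.

Definition emb_map n (p : 'rV[R]_2) (x : 'rV[R]_(2 * n)) : 'rV[R]_(2 * n) :=
  \row_i emb (p ord0 0) (p ord0 1) (coord x) i.

Lemma is_derive_mxcoord m (x v : 'rV[R]_m) i :
  is_derive x v (fun y : 'rV[R]_m => y ord0 i) (v ord0 i).
Proof.
have did : derivable (id : 'rV[R]_m -> 'rV[R]_m) x v by exact: derivable_id.
have dc := (derivable_mxP _ _ _).1 did ord0 i.
apply: DeriveDef => //.
by have /matrixP/(_ ord0 i) := derive_mx did; rewrite derive_id mxE.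
Qed.

Lemma is_derive_coord m (x v : 'rV[R]_m) k :
  is_derive x v (fun y : 'rV[R]_m => coord y k) (coord v k).
Proof.
case: (ltnP k m) => h; last first.
  rewrite coord_ge//; apply: is_derive_ext (is_derive_cst (0 : R) x v) => y.
  by rewrite coord_ge.
rewrite coord_lt; apply: is_derive_ext (is_derive_mxcoord x v (Ordinal h)) => y.
by rewrite coord_lt.
Qed.

Lemma emb_ge6 S r (x : nat -> R) k : (6 <= k)%N -> emb S r x k = x k.
Proof. by move=> k6; rewrite -(subnK k6) addnC. Qed.

Lemma emb_tangent_ge6 S r x L W H H1 P Z (a : nat -> R) k : (6 <= k)%N ->
  emb_tangent S r x L W H H1 P Z a k = a k.
Proof. by move=> k6; rewrite -(subnK k6) addnC. Qed.

Lemma smooth_mxcoord m (A : set 'rV[R]_m) i : smooth A (fun y => y ord0 i).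
Proof.
have c x : {for x, continuous (fun y : 'rV[R]_m => y ord0 i)}.
  exact: coord_continuous.
case=> [|k]; first by split=> // x _; exact: c.
split=> [x _|v]; first exact: c.
exists (fun=> v ord0 i); first exact: Ck_cst.
by move=> x _; exact: is_derive_mxcoord.
Qed.

Lemma smooth_coord m (A : set 'rV[R]_m) k : smooth A (fun y => coord y k).
Proof.
case: (ltnP k m) => h.
  by under eq_fun do rewrite coord_lt; exact: smooth_mxcoord.
by under eq_fun do rewrite coord_ge//; exact: smooth_cst.
Qed.

Lemma open_smooth_lt m (f g : 'rV[R]_m -> R) : smooth setT f -> smooth setT g ->
  open [set y | f y < g y].
Proof.
move=> fs gs.
have -> : [set y | f y < g y] = setT `&` [set y | [set t : R | 0 < t] (g y - f y)].
  by apply/seteqP; split=> y /=; rewrite subr_gt0; [|case].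
apply: open_preimage_in; [exact: openT| |exact: open_gt0].
move=> x _; exact: smooth_continuous (smoothB gs fs) I.
Qed.

Lemma sqsum_recl m (x : 'rV[R]_m) a b : (a < b)%N ->
  sqsum x a b = coord x a ^+ 2 + sqsum x a.+1 b.
Proof. by move=> ab; rewrite /sqsum big_ltn. Qed.

Lemma sqsum_ge0 m (x : 'rV[R]_m) a b : 0 <= sqsum x a b.
Proof. by apply: sumr_ge0 => k _; exact: sqr_ge0. Qed.

Lemma sqsum_geq m (x : 'rV[R]_m) a b : (b <= a)%N -> sqsum x a b = 0.
Proof. by move=> ba; rewrite /sqsum big_geq. Qed.

Lemma norm_lt_of_sqr (t S : R) : 0 < S -> t ^+ 2 < S ^+ 2 -> `|t| < S.
Proof.
by move=> S0; rewrite -real_normK ?num_real// ltr_sqr ?nnegrE// ltW.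
Qed.

Lemma dom_bounds n (S : R) (x : 'rV[R]_(2 * n)) : (3 <= n)%N -> 0 < S ->
  dom_SR n S x ->
  [/\ coord x 0 ^+ 2 + coord x 1 ^+ 2 < 1, `|coord x 2| < S, `|coord x 3| < S,
      `|coord x 4| < S /\ `|coord x 5| < S & sqsum x 6 (2 * n) <= S ^+ 2].
Proof.
move=> n3 S0 [].
have n6 : (6 <= 2 * n)%N by rewrite (leq_mul2l 2 3).
rewrite !(@sqsum_recl _ _ 0, @sqsum_recl _ _ 1)// sqsum_geq// addr0 => h1.
rewrite (@sqsum_recl _ _ 2) ?(leq_trans _ n6)// (@sqsum_recl _ _ 3) ?(leq_trans _ n6)//.
rewrite (@sqsum_recl _ _ 4) ?(leq_trans _ n6)// (@sqsum_recl _ _ 5)// => h2.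
have a2 := sqr_ge0 (coord x 2); have a3 := sqr_ge0 (coord x 3).
have a4 := sqr_ge0 (coord x 4); have a5 := sqr_ge0 (coord x 5).
have a6 := sqsum_ge0 x 6 (2 * n).
split=> //; [| |split|]; try apply: norm_lt_of_sqr => //; clear -a2 a3 a4 a5 a6 h2; lra.
Qed.

Lemma param_admissible n (p : 'rV[R]_2) (x : 'rV[R]_(2 * n)) : (3 <= n)%N ->
  param_set 1 p -> dom_SR n (p ord0 0) x ->
  admissible (p ord0 0) (p ord0 1) (coord x).
Proof.
move=> n3 [S0 [r3 _]] dx; have [h1 h2 _ _ _] := dom_bounds n3 S0 dx.
by split=> //; rewrite /gap subr_gt0.
Qed.

Lemma smooth_sqsum m (A : set 'rV[R]_m) k (L : 'rV[R]_m -> 'rV[R]_k) a b :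
  (forall j, smooth A (fun y => coord (L y) j)) ->
  smooth A (fun y => sqsum (L y) a b).
Proof.
move=> Ls j; rewrite /sqsum; apply: Ck_sum => i.
by under eq_fun do rewrite expr2; apply: CkM; exact: Ls.
Qed.

Lemma open_dom_SR n (S : R) : open (@dom_SR R n S).
Proof.
apply: openI; apply: open_smooth_lt; try exact: smooth_cst;
  by apply: smooth_sqsum => j; exact: smooth_coord.
Qed.

Lemma coord_emb_map n (p : 'rV[R]_2) (x : 'rV[R]_(2 * n)) k : (k < 2 * n)%N ->
  coord (emb_map p x) k = emb (p ord0 0) (p ord0 1) (coord x) k.
Proof. by move=> h; rewrite coord_lt mxE. Qed.

Section FixedParameter.
Variables (n : nat) (p : 'rV[R]_2).
Hypotheses (n3 : (3 <= n)%N) (hp : param_set 1 p).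
Local Notation A := (dom_SR n (p ord0 0)).
Local Notation F := (@emb_map n p).

Lemma emb_map_smooth : smooth_on A F.
Proof.
apply: smooth_on_coord; first exact: open_dom_SR.
move=> i; have -> : (fun x => F x ord0 i) =
    (fun x => emb (p ord0 0) (p ord0 1) (fun k => coord x k) i).
  by apply/funext => x; rewrite mxE.
apply: (@smooth_emb _ _ A (fun=> p ord0 0) (fun=> p ord0 1) (fun k x => coord x k)).
- exact: open_dom_SR.
- exact: smooth_cst.
- exact: smooth_cst.
- by move=> k; exact: smooth_coord.
- by move=> x; exact: param_admissible.
Qed.

Lemma emb_map_injective : {in A &, injective F}.
Proof.
move=> x x' /set_mem Ax /set_mem Ax' E.
have S0 : 0 < p ord0 0 by case: hp.
have [_ _ _ [h4 _] _] := dom_bounds n3 S0 Ax.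
have [_ _ _ [h4' _] _] := dom_bounds n3 S0 Ax'.
suff cE : coord x =1 coord x' by apply/rowP => i; rewrite -!coordE cE.
apply: (emb_inj (param_admissible n3 hp Ax) (param_admissible n3 hp Ax')).
  move: h4 h4'; rewrite !ltr_norml => /andP[a1 a2] /andP[b1 b2].
  by apply/andP; split; clear -a1 a2 b1 b2; lra.
move=> i; case: (ltnP i (2 * n)) => hi; first by rewrite -!coord_emb_map// E.
(* Beyond the dimension [coord] has the default value 0, and 3 <= n puts these indices among those
   that [emb] leaves fixed. *)
have i6 : (6 <= i)%N by apply: leq_trans hi; rewrite (leq_mul2l 2 3).
by rewrite !emb_ge6// !coord_ge.
Qed.

Lemma omega_first_three (a b : nat -> R) : \sum_(0 <= i < n)
    (a (2 * i)%N * b (2 * i + 1)%N - a (2 * i + 1)%N * b (2 * i)%N) =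
  (a 0%N * b 1%N - a 1%N * b 0%N) + (a 2%N * b 3%N - a 3%N * b 2%N)
  + (a 4%N * b 5%N - a 5%N * b 4%N) + \sum_(3 <= i < n)
    (a (2 * i)%N * b (2 * i + 1)%N - a (2 * i + 1)%N * b (2 * i)%N).
Proof.
rewrite big_ltn ?(leq_trans _ n3)// big_ltn ?(leq_trans _ n3)// big_ltn//.
by rewrite !addrA.
Qed.

Lemma emb_map_symplectic x u v : A x ->
  omega (derive F x u) (derive F x v) = omega u v.
Proof.
move=> Ax; have adm := param_admissible n3 hp Ax.
have [L [W [H [H1 [P [Z [cases D]]]]]]] := is_derive_emb
  (xf := fun k y => coord y k) adm.
pose T := emb_tangent (p ord0 0) (p ord0 1) (coord x) L W H H1 P Z.
have cD d k : (k < 2 * n)%N -> coord ('D_d F x) k = T (coord d) k.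
  move=> hk; rewrite coord_lt.
  have [_ <-] := derive_coord d (Ordinal hk) emb_map_smooth Ax.
  have Dk : is_derive x d (fun y => emb (p ord0 0) (p ord0 1) (coord y) k)
    (T (coord d) k) := D d (coord d) (fun j => is_derive_coord x d j) k.
  have [_ <-] := Dk.
  by congr ('D_d _ x); apply/funext => y; rewrite mxE.
have lt2 i : (i < n)%N -> (2 * i < 2 * n)%N /\ (2 * i + 1 < 2 * n)%N.
  by move=> h; rewrite ltn_mul2l /= h addn1 !mul2n ltn_Sdouble.
have omegaE (T' : (nat -> R) -> nat -> R) :
    (forall d k, (k < 2 * n)%N -> coord ('D_d F x) k = T' (coord d) k) ->
    omega ('D_u F x) ('D_v F x) = \sum_(0 <= i < n)
    (T' (coord u) (2 * i)%N * T' (coord v) (2 * i + 1)%N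
     - T' (coord u) (2 * i + 1)%N * T' (coord v) (2 * i)%N).
  move=> h; rewrite /omega; apply: eq_big_nat => i /andP[_ /lt2[h1 h2]].
  by congr (_ * _ - _ * _); exact: h.
rewrite (omegaE _ cD) (omega_first_three (T (coord u)) (T (coord v))).
rewrite (emb_tangent_symplectic L (coord u) (coord v) adm cases).
rewrite /omega (omega_first_three (coord u) (coord v)); congr (_ + _).
apply: eq_big_nat => i /andP[i3 _].
have h6 : (6 <= 2 * i)%N by rewrite (leq_mul2l 2 3).
by rewrite /T !emb_tangent_ge6// addn1 leqW.
Qed.

Lemma emb_map_target x : A x ->
  tgt_SR n (p ord0 1) (34 * p ord0 0 ^+ 2 / Num.sqrt (p ord0 1 - Num.sqrt 3)) (F x).
Proof.
move=> Ax; have adm := param_admissible n3 hp Ax.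
case: (hp) => S0 [r3 rS]; have [_ _ h3 [h4 h5] h6] := dom_bounds n3 S0 Ax.
have n6 : (6 <= 2 * n)%N by rewrite (leq_mul2l 2 3).
have lt6 k : (k < 6)%N -> (k < 2 * n)%N by move=> h; exact: leq_trans n6.
have gS : gap (p ord0 1) < p ord0 0 ^+ 2 by move: rS; rewrite mul1r /gap ltrBlDl.
split.
  rewrite !(@sqsum_recl _ _ 0, @sqsum_recl _ _ 1, @sqsum_recl _ _ 2, @sqsum_recl _ _ 3)//.
  rewrite sqsum_geq// addr0 !coord_emb_map ?lt6//.
  by have := emb_first_ball adm; rewrite !addrA.
rewrite (@sqsum_recl _ _ 4) ?lt6// (@sqsum_recl _ _ 5) ?lt6// !coord_emb_map ?lt6//.
have -> : sqsum (F x) 6 (2 * n) = sqsum x 6 (2 * n).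
  by apply: eq_big_nat => k /andP[k6 kn]; rewrite coord_emb_map// emb_ge6.
by have := emb_second_ball adm gS h3 h4 h5 h6; rewrite addrA.
Qed.

(** Immersivity and continuity of the inverse both come from the nondegeneracy of omega. *)
Lemma emb_map_embedding : symplectic_embedding A F.
Proof.
have fs := emb_map_smooth; have fi := emb_map_injective.
split; last by move=> x u v; exact: emb_map_symplectic.
split=> //; split=> //; split; last first.
  by apply: symplectic_inverse_continuous => //; exact: emb_map_symplectic.
move=> x v Ax dv; apply: omega_nondegenerate => u.
by rewrite -(emb_map_symplectic v u Ax) dv omega0l.
Qed.

End FixedParameter.

Lemma emb_map_smooth_family n : (3 <= n)%N ->
  smooth_family (param_set 1) (fun p => dom_SR n (p ord0 0)) (@emb_map n).
Proof.
move=> n3; rewrite /smooth_family; set B := (X in smooth_on X).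
have ls i : smooth setT (fun y : 'rV[R]_(2 + 2 * n) => lsubmx y ord0 i).
  by under eq_fun do rewrite mxE; exact: smooth_mxcoord.
have rcs j : smooth setT (fun y : 'rV[R]_(2 + 2 * n) => coord (rsubmx y) j).
  case: (ltnP j (2 * n)) => h.
    by under eq_fun do rewrite coord_lt mxE; exact: smooth_mxcoord.
  by under eq_fun do rewrite coord_ge//; exact: smooth_cst.
have S2 : smooth setT (fun y : 'rV[R]_(2 + 2 * n) => lsubmx y ord0 0 ^+ 2).
  by under eq_fun do rewrite expr2; exact: smoothM.
pose S (y : 'rV[R]_(2 + 2 * n)) := lsubmx y ord0 0.
pose r (y : 'rV[R]_(2 + 2 * n)) := lsubmx y ord0 1.
have oB : open B.
  have -> : B = ([set y | 0 < S y] `&` ([set y | Num.sqrt 3 < r y] `&`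
      [set y | r y < Num.sqrt 3 + 1 * S y ^+ 2])) `&`
      ([set y | sqsum (rsubmx y) 0 2 < 1] `&`
       [set y | sqsum (rsubmx y) 2 (2 * n) < S y ^+ 2]) by [].
  have c0 (c : R) : smooth setT (fun _ : 'rV[R]_(2 + 2 * n) => c) by exact: smooth_cst.
  apply: openI; first (apply: openI; last apply: openI); last apply: openI;
    apply: open_smooth_lt => //; try exact: smooth_sqsum; try exact: ls.
  by apply: smoothD => //; exact: smoothM.
apply: smooth_on_coord => // i.
have -> : (fun y : 'rV[R]_(2 + 2 * n) => emb_map (lsubmx y) (rsubmx y) ord0 i) =
    (fun y => emb (lsubmx y ord0 0) (lsubmx y ord0 1) (fun k => coord (rsubmx y) k) i).
  by apply/funext => y; rewrite mxE.
apply: (@smooth_emb _ _ B (fun y => lsubmx y ord0 0) (fun y => lsubmx y ord0 1)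
  (fun k y => coord (rsubmx y) k)) => //.
- by apply: smooth_sub (ls 0).
- by apply: smooth_sub (ls 1).
- by move=> k; apply: smooth_sub (rcs k).
- by move=> y [py dy]; exact: param_admissible.
Qed.

End EmbeddingMap.

Theorem theorem5p2 (R : realType) (n : nat) : (3 <= n)%N ->
  exists C C' : R, 0 < C /\ 0 < C' /\
  exists F : 'rV[R]_2 -> 'rV[R]_(2 * n) -> 'rV[R]_(2 * n),
    smooth_family (param_set C') (fun p => dom_SR n (p ord0 0)) F /\
    forall p : 'rV[R]_2, param_set C' p ->
      let S := p ord0 0 in let Rad := p ord0 1 in
      symplectic_embedding (dom_SR n S) (F p) /\
      (forall x, dom_SR n S x ->
         tgt_SR n Rad (C * S ^+ 2 / Num.sqrt (Rad - Num.sqrt 3)) (F p x)).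
Proof.
(* C' = 1 is the condition gap < S^2 of the size estimates; C = 34 comes from [emb_second_ball]. *)
move=> n3; exists 34, 1; do 2![split; first by []].
exists (@emb_map R n); split; first exact: emb_map_smooth_family.
move=> p hp /=; split; first exact: emb_map_embedding.
by move=> x; exact: emb_map_target.
Qed.
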